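(* Let $a,b\in\mathbb{C}$ and let $V$ be a nontrivial $\mathbb{Z}$-graded free intermediate series module over $CHV(a,b)$. (1) If $a\neq1$ or $b\neq0$, then $V\cong V'_{\alpha,\beta}$ or $V\cong V'_{A,\beta}$ for some $A\in\{0,1\}^\infty$, $\alpha,\beta\in\mathbb{C}$. (2) If $a=1$ and $b=0$, then $V\cong V'_{\alpha,\beta,d}$ or $V\cong V'_{A,\beta,d}$ for some $A\in\{0,1\}^\infty$, $\alpha,\beta,d\in\mathbb{C}$.
   Context: A Lie conformal algebra is a $\mathbb{C}[\partial]$-module $R$ with a $\mathbb{C}$-linear map ($\lambda$-bracket) $R\otimes R\to R[\lambda]=\mathbb{C}[\lambda]\otimes R$, $x\otimes y\mapsto[x{}_\lambda y]$, satisfying $[\partial x{}_\lambda y]=-\lambda[x{}_\lambda y]$, $[x{}_\lambda\partial y]=(\partial+\lambda)[x{}_\lambda y]$, $[x{}_\lambda y]=-[y{}_{-\lambda-\partial}x]$ and $[x{}_\lambda[y{}_\mu z]]=[[x{}_\lambda y]{}_{\lambda+\mu}z]+[y{}_\mu[x{}_\lambda z]]$. For $a,b\in\mathbb{C}$, $CHV(a,b)$ is the Lie conformal algebra that is free over $\mathbb{C}[\partial]$ with basis $\{L_i,M_i\mid i\in\mathbb{Z}\}$ and $\lambda$-brackets $$[L_i{}_\lambda L_j]=(\partial+2\lambda)L_{i+j},\quad [L_i{}_\lambda M_j]=(\partial+a\lambda+b)M_{i+j},\quad[M_i{}_\lambda M_j]=0,$$ with $[M_i{}_\lambda L_j]$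 determined by skew-symmetry. It is $\mathbb{Z}$-graded by $(CHV(a,b))_i=\mathbb{C}[\partial]L_i\oplus\mathbb{C}[\partial]M_i$. A conformal module $V$ over a Lie conformal algebra $R$ is a $\mathbb{C}[\partial]$-module with a $\mathbb{C}$-linear $\lambda$-action $R\otimes V\to V[\lambda]$, $x\otimes v\mapsto x{}_\lambda v$, such that $(\partial x){}_\lambda v=-\lambda\,x{}_\lambda v$, $x{}_\lambda(\partial v)=(\partial+\lambda)x{}_\lambda v$ and $x{}_\lambda(y{}_\mu v)-y{}_\mu(x{}_\lambda v)=[x{}_\lambda y]{}_{\lambda+\mu}v$. If $R=\oplus_{i\in\mathbb{Z}}R_i$ is $\mathbb{Z}$-graded, $V$ is $\mathbb{Z}$-graded if $V=\oplus_{i\in\mathbb{Z}}V_i$ with $V_i$ $\mathbb{C}[\partial]$-submodules and $R_i{}_\lambda V_j\subset V_{i+j}[\lambda]$; if moreover each $V_i$ is freely generated over $\mathbb{C}[\partial]$ by one element $v_i\in V_i$, then $V$ is a $\mathbb{Z}$-graded free intermediate series module. Nontrivial means that the $\lambda$-action is not identically zero. $\{0,1\}^\infty$ is the set of sequences $A=\{a_i\}_{i\in\mathbb{Z}}$ with $a_i\in\{0,1\}$. All of the following have underlying free $\mathbb{C}[\partial]$-module $\oplus_{m\in\mathbb{Z}}\mathbb{C}[\partial]v_m$, with $\lambda$-actions given by ($i,m\in\mathbb{Z}$): - $V'_{\alpha,\beta}$ ($\alpha,\beta\in\mathbb{C}$): $L_i{}_\lambda v_m=(\partial+\alpha\lambda+\beta)v_{i+m}$,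 $M_i{}_\lambda v_m=0$. - $V'_{A,\beta}$ ($A\in\{0,1\}^\infty$, $\beta\in\mathbb{C}$): $M_i{}_\lambda v_m=0$ and $$L_i{}_\lambda v_m=\begin{cases} (\partial+\beta)v_{i+m} & \text{if }(a_m,a_{i+m})=(0,0), \\ (\partial+\beta+\lambda)v_{i+m} & \text{if }(a_m,a_{i+m})=(1,1), \\ {v_{i+m}} & \text{if }(a_m,a_{i+m})=(0,1), \\ (\partial+\beta)(\partial+\beta+\lambda)v_{i+m} & \text{if }(a_m,a_{i+m})=(1,0).\end{cases}$$ - $V'_{\alpha,\beta,d}$, resp. $V'_{A,\beta,d}$ ($d\in\mathbb{C}$; used for $CHV(1,0)$): the same action of $L_i$ as on $V'_{\alpha,\beta}$, resp. $V'_{A,\beta}$, together with $M_i{}_\lambda v_m=d\,v_{i+m}$. $\cong$ means that there is a $\mathbb{C}[\partial]$-module isomorphism commuting with the $\lambda$-actions. *)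

(* Defs.v *)
From HB Require Import structures.
From mathcomp Require Import all_boot all_order all_algebra finmap complex reals.
From mathcomp Require Import monalg.
From mathcomp Require Import ring.

Set Implicit Arguments.
Unset Strict Implicit.
Unset Printing Implicit Defensive.

Import GRing.Theory.
Local Open Scope ring_scope.

(* K plays the role of the complex numbers.  A K[del]-module is an
   [lmodType {poly K}]: the operator del is ['X *: _] and the scalar c acts as
   [c%:P *: _].  The free K[del]-module with basis G is
   [{malg {poly K}[G]}]. *)

(* V[lambda], the polynomials in lambda with coefficients in V:
   the coefficient of lambda^n in p is [p@_n]. *)
Notation lpoly V := {malg V[nat]}.

(* the coefficient of lambda^n in lambda * p(lambda) *)
Definition mul_lambda (V : zmodType) (p : lpoly V) (n : nat) : V :=
  if n is k.+1 then p@_k else 0.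

(* the coefficient of lambda^n in
   p(- lambda - del) = \sum_m (- lambda - del)^m p_m *)
Definition skew_subst (K : fieldType) (V : lmodType {poly K}) (p : lpoly V)
    (n : nat) : V :=
  \sum_(m <- msupp p) (((-1) ^+ m * 'X^(m - n)) *+ 'C(m, n)) *: p@_m.

(* the coefficient of lambda^m mu^n in
   p_(lambda + mu) v = \sum_k lambda^k (p_k)_(lambda + mu) v,
   for p = \sum_k lambda^k p_k in R[lambda] *)
Definition bracket_act (R V : zmodType) (act : R -> V -> lpoly V)
    (p : lpoly R) (v : V) (m n : nat) : V :=
  \sum_(k < m.+1) (act p@_(k : nat) v)@_(m - k + n)%N *+ 'C(m - k + n, n).

Record sesquilinear (K : fieldType) (R V : lmodType {poly K})
    (f : R -> V -> lpoly V) : Prop := Sesquilinear {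
  sesq_linearl : forall (c : K) (x y : R) (v : V) (n : nat),
    (f (c%:P *: x + y) v)@_n = c%:P *: (f x v)@_n + (f y v)@_n;
  sesq_linearr : forall (c : K) (x : R) (v w : V) (n : nat),
    (f x (c%:P *: v + w))@_n = c%:P *: (f x v)@_n + (f x w)@_n;
  sesq_derl : forall (x : R) (v : V) (n : nat),
    (f ('X *: x) v)@_n = - mul_lambda (f x v) n;
  sesq_derr : forall (x : R) (v : V) (n : nat),
    (f x ('X *: v))@_n = 'X *: (f x v)@_n + mul_lambda (f x v) n
}.

(* x_lambda (y_mu v) - y_mu (x_lambda v) = [x_lambda y]_(lambda + mu) v,
   compared at lambda^m mu^n *)
Definition action_law (R V : zmodType) (br : R -> R -> lpoly R)
    (act : R -> V -> lpoly V) : Prop :=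
  forall (x y : R) (v : V) (m n : nat),
    (act x (act y v)@_n)@_m - (act y (act x v)@_m)@_n
    = bracket_act act (br x y) v m n.

(* [br_jacobi] is [action_law] for the adjoint action. *)
Record is_lie_conformal (K : fieldType) (R : lmodType {poly K})
    (br : R -> R -> lpoly R) : Prop := IsLieConformal {
  br_sesquilinear : sesquilinear br;
  br_skew : forall (x y : R) (n : nat),
    (br x y)@_n = - skew_subst (br y x) n;
  br_jacobi : action_law br br
}.

Record lieConformalAlg (K : fieldType) := LieConformalAlg {
  lca_carrier :> lmodType {poly K};
  lca_bracket : lca_carrier -> lca_carrier -> lpoly lca_carrier;
  lca_axioms : is_lie_conformal lca_bracket
}.

Record conformal_module (K : fieldType) (R : lieConformalAlg K)
    (V : lmodType {poly K}) (act : R -> V -> lpoly V) : Prop :=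
  ConformalModule {
    cm_sesquilinear : sesquilinear act;
    cm_law : action_law (@lca_bracket K R) act
  }.

(* V is the internal direct sum of the K[del]-submodules [Vg i];
   [c : {malg V[int]}] is a finitely supported family (c_i)_i. *)
Record is_grading (K : fieldType) (V : lmodType {poly K})
    (Vg : int -> V -> Prop) : Prop := IsGrading {
  grading_zero : forall i, Vg i 0;
  grading_linear : forall i (p : {poly K}) (u v : V),
    Vg i u -> Vg i v -> Vg i (p *: u + v);
  grading_span : forall v : V, exists c : {malg V[int]},
    (forall i, Vg i c@_i) /\ v = \sum_(i <- msupp c) c@_i;
  grading_direct : forall c : {malg V[int]},
    (forall i, Vg i c@_i) -> \sum_(i <- msupp c) c@_i = 0 -> c = 0
}.

Definition graded_action (R V : zmodType) (Rg : int -> R -> Prop)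
    (Vg : int -> V -> Prop) (act : R -> V -> lpoly V) : Prop :=
  forall (i j : int) (x : R) (v : V),
    Rg i x -> Vg j v -> forall n : nat, Vg (i + j) (act x v)@_n.

Definition freely_generated_by (K : fieldType) (V : lmodType {poly K})
    (W : V -> Prop) (w : V) : Prop :=
  [/\ W w,
      (forall u, W u -> exists p : {poly K}, u = p *: w)
    & (forall p : {poly K}, p *: w = 0 -> p = 0)].

Record graded_free_intermediate_series (K : fieldType) (R : lieConformalAlg K)
    (Rg : int -> R -> Prop) (V : lmodType {poly K})
    (act : R -> V -> lpoly V) : Prop := GradedFreeIntermediateSeries {
  gfis_module : conformal_module act;
  gfis_graded : exists Vg : int -> V -> Prop,
    [/\ is_grading Vg, graded_action Rg Vg act
      & forall i, exists v, freely_generated_by (Vg i) v]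
}.

Definition nontrivial_action (R V : zmodType) (act : R -> V -> lpoly V) : Prop :=
  exists x v, act x v <> 0.

Definition isomorphic_actions (K : fieldType) (R V W : lmodType {poly K})
    (act : R -> V -> lpoly V) (act' : R -> W -> lpoly W) : Prop :=
  exists f : {linear V -> W}, bijective f /\
    forall (x : R) (v : V) (n : nat), f (act x v)@_n = (act' x (f v))@_n.

(* K[del][lambda], as {poly {poly K}}: the outer variable is lambda *)
Definition pd (K : fieldType) : {poly {poly K}} := 'X%:P.
Definition plam (K : fieldType) : {poly {poly K}} := 'X.
Definition pcst (K : fieldType) (c : K) : {poly {poly K}} := c%:P%:P.

(* For K[del]-modules with bases e_g (g : G) and e_h (h : H), the sesquilinear
   extension of  (e_g)_lambda e_h = F g h (del, lambda) e_(t g h),  that is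
     (p(del) e_g)_lambda (q(del) e_h)
       = p(- lambda) q(del + lambda) F g h (del, lambda) e_(t g h). *)
Definition free_coef (K : fieldType) (p q : {poly K}) (F : {poly {poly K}}) :
    {poly {poly K}} :=
  (map_poly polyC p \Po - plam K) * (map_poly polyC q \Po (pd K + plam K)) * F.

Definition free_action (K : fieldType) (G H : choiceType) (t : G -> H -> H)
    (F : G -> H -> {poly {poly K}})
    (x : {malg {poly K}[G]}) (v : {malg {poly K}[H]}) :
    lpoly {malg {poly K}[H]} :=
  \sum_(g <- msupp x) \sum_(h <- msupp v)
    \sum_(n < size (free_coef x@_g v@_h (F g h)))
      << << (free_coef x@_g v@_h (F g h))`_n *g t g h >> *g (n : nat) >>.

(* The basis of CHV(a,b): [inl i] stands for L_i and [inr i] for M_i. *)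
Definition chv_index : choiceType := (int + int)%type.

Definition chv_carrier (K : fieldType) : lmodType {poly K} :=
  {malg {poly K}[chv_index]}.

Definition chvL (K : fieldType) (i : int) : chv_carrier K :=
  << 1 *g (inl i : chv_index) >>.
Definition chvM (K : fieldType) (i : int) : chv_carrier K :=
  << 1 *g (inr i : chv_index) >>.

Definition chv_target (g h : chv_index) : chv_index :=
  match g, h with
  | inl i, inl j => inl (i + j)
  | inl i, inr j | inr i, inl j | inr i, inr j => inr (i + j)
  end.

(* For M_i, L_j, skew-symmetry gives
   - (del + a (- lambda - del) + b) = (a - 1) del + a lambda - b. *)
Definition chv_coef (K : fieldType) (a b : K) (g h : chv_index) :
    {poly {poly K}} :=
  match g, h with
  | inl _, inl _ => pd K + pcst 2 * plam K
  | inl _, inr _ => pd K + pcst a * plam K + pcst b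
  | inr _, inl _ => pcst (a - 1) * pd K + pcst a * plam K - pcst b
  | inr _, inr _ => 0
  end.

Definition chv_bracket (K : fieldType) (a b : K) :
    chv_carrier K -> chv_carrier K -> lpoly (chv_carrier K) :=
  free_action chv_target (chv_coef a b).

Section FreeAction.
Context {K : fieldType}.

Lemma lpoly_bound (V : zmodType) (p : lpoly V) :
  exists N, forall n, (N <= n)%N -> p@_n = 0.
Proof.
exists (\max_(i <- msupp p) i).+1 => n le_n.
apply: mcoeff_outdom; apply: contraL le_n => n_in.
by rewrite -ltnNge ltnS (big_fsetD1 n) //= leq_maxl.
Qed.

Lemma free_ind (G : choiceType) (P : {malg {poly K}[G]} -> Prop) :
  P 0 -> (forall (c : K) x y, P x -> P y -> P (c%:P *: x + y)) ->
  (forall x, P x -> P ('X *: x)) -> (forall g, P << 1 *g g >>) ->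
  forall x, P x.
Proof.
move=> P0 Plin PX Pg x.
have Padd u v : P u -> P v -> P (u + v).
  by move=> Pu Pv; rewrite -[u]scale1r -polyC1; apply: Plin.
have PZ (p : {poly K}) u : P u -> P (p *: u).
  move=> Pu; elim/poly_ind: p => [|p c IH]; first by rewrite scale0r.
  rewrite addrC scalerDl mulrC -scalerA; apply: Plin => //.
  exact: PX.
rewrite [x]monalgE; elim/big_ind: _ => // g _.
rewrite (_ : << _ *g g >> = x@_g *: << 1 *g g >>); first exact: PZ.
by apply/malgP => k; rewrite mcoeffZ !mcoeffU mulrnAr mulr1.
Qed.

Lemma free_coefDl (c : K) p p' q F :
  free_coef (c%:P * p + p') q F = c%:P *: free_coef p q F + free_coef p' q F.
Proof.
rewrite /free_coef rmorphD rmorphM /= map_polyC /= comp_polyD comp_polyM.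
by rewrite comp_polyC !mulrDl -!mulrA -mul_polyC.
Qed.

Lemma free_coefDr (c : K) p q q' F :
  free_coef p (c%:P * q + q') F = c%:P *: free_coef p q F + free_coef p q' F.
Proof.
rewrite /free_coef rmorphD rmorphM /= map_polyC /= comp_polyD comp_polyM.
rewrite comp_polyC -mul_polyC; ring.
Qed.

Lemma free_coefXl p q F :
  free_coef ('X * p) q F = - (free_coef p q F * 'X) :> {poly {poly K}}.
Proof.
rewrite /free_coef rmorphM /= map_polyX comp_polyM comp_polyX /plam; ring.
Qed.

Lemma free_coefXr p q F :
  free_coef p ('X * q) F =
  'X *: free_coef p q F + free_coef p q F * 'X :> {poly {poly K}}.
Proof.
rewrite /free_coef rmorphM /= map_polyX comp_polyM comp_polyX /plam /pd.
rewrite -mul_polyC; ring.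
Qed.

Lemma free_coef0l q F : free_coef 0 q F = 0 :> {poly {poly K}}.
Proof. by rewrite /free_coef rmorph0 comp_poly0 !mul0r. Qed.

Lemma free_coef0r p F : free_coef p 0 F = 0 :> {poly {poly K}}.
Proof. by rewrite /free_coef rmorph0 comp_poly0 mulr0 mul0r. Qed.

Lemma free_coef11 F : free_coef 1 1 F = F :> {poly {poly K}}.
Proof. by rewrite /free_coef rmorph1 -polyC1 !comp_polyC polyC1 !mul1r. Qed.

Section OneAction.
Context (G H : choiceType) (t : G -> H -> H) (F : G -> H -> {poly {poly K}}).
Implicit Types (x : {malg {poly K}[G]}) (v : {malg {poly K}[H]}).

Lemma free_actionE x v n (A : {fset G}) (B : {fset H}) :
  (msupp x `<=` A)%fset -> (msupp v `<=` B)%fset ->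
  (free_action t F x v)@_n =
  \sum_(g <- A) \sum_(h <- B) << (free_coef x@_g v@_h (F g h))`_n *g t g h >>.
Proof.
move=> sA sB; rewrite /free_action raddf_sum /=.
rewrite (big_fset_incl _ sA) /=; last first.
  move=> g _ /mcoeff_outdom g0; rewrite raddf_sum big1 // => h _.
  by rewrite g0 free_coef0l size_poly0 big_ord0 raddf0.
apply: eq_bigr => g _; rewrite raddf_sum /=.
rewrite (big_fset_incl _ sB) /=; last first.
  move=> h _ /mcoeff_outdom h0.
  by rewrite h0 free_coef0r size_poly0 big_ord0 raddf0.
apply: eq_bigr => h _; rewrite raddf_sum /=.
set P := free_coef _ _ _.
have [lt_n|le_n] := ltnP n (size P).
  rewrite (bigD1 (Ordinal lt_n)) //= mcoeffUU big1 ?addr0 // => i ne_i.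
  by rewrite mcoeffU; case: eqP => // E; case/eqP: ne_i; apply: val_inj.
rewrite nth_default // monalgU0 big1 // => i _; rewrite mcoeffU.
by case: eqP => // E; move: (ltn_ord i); rewrite E ltnNge le_n.
Qed.

Lemma free_action_gen (g : G) (h : H) n :
  (free_action t F << 1 *g g >> << 1 *g h >>)@_n = << (F g h)`_n *g t g h >>.
Proof.
rewrite (@free_actionE _ _ _ [fset g]%fset [fset h]%fset) ?msuppU_le //.
by rewrite !big_seq_fset1 !mcoeffUU free_coef11.
Qed.

Lemma monalgUZ (p q : {poly K}) (h : H) :
  p *: << q *g h >> = << p * q *g h >> :> {malg {poly K}[H]}.
Proof. by apply/malgP => k; rewrite mcoeffZ !mcoeffU mulrnAr. Qed.

Lemma eq_lin (V : lmodType {poly K}) (c : {poly K}) (u u' v v' w w' : V) :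
  u = u' -> v = v' -> w = w' -> u' = c *: v' + w' -> u = c *: v + w.
Proof. by move=> -> -> ->. Qed.

Lemma free_action_sesquilinear : sesquilinear (free_action t F).
Proof.
split=> [c x y v n|c x v w n|x v n|x v n].
- pose A := (msupp x `|` msupp y `|` msupp (c%:P *: x + y))%fset.
  have sx : (msupp x `<=` A)%fset by rewrite /A -fsetUA fsubsetUl.
  have sy : (msupp y `<=` A)%fset
    by rewrite /A fsetUAC fsubsetUr.
  have sz : (msupp (c%:P *: x + y)%R `<=` A)%fset by rewrite /A fsubsetUr.
  apply: (eq_lin (@free_actionE _ v n _ _ sz (fsubset_refl _))
    (@free_actionE x v n _ _ sx (fsubset_refl _))
    (@free_actionE y v n _ _ sy (fsubset_refl _))).
  rewrite scaler_sumr -big_split; apply: eq_bigr => g _ /=.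
  rewrite scaler_sumr -big_split; apply: eq_bigr => h _ /=.
  rewrite mcoeffD mcoeffZ free_coefDl coefD coefZ monalgUD.
  by rewrite monalgUZ.
- pose B := (msupp v `|` msupp w `|` msupp (c%:P *: v + w))%fset.
  have sv : (msupp v `<=` B)%fset by rewrite /B -fsetUA fsubsetUl.
  have sw : (msupp w `<=` B)%fset
    by rewrite /B fsetUAC fsubsetUr.
  have sz : (msupp (c%:P *: v + w)%R `<=` B)%fset by rewrite /B fsubsetUr.
  apply: (eq_lin (@free_actionE x _ n _ _ (fsubset_refl _) sz)
    (@free_actionE x v n _ _ (fsubset_refl _) sv)
    (@free_actionE x w n _ _ (fsubset_refl _) sw)).
  rewrite scaler_sumr -big_split; apply: eq_bigr => g _ /=.
  rewrite scaler_sumr -big_split; apply: eq_bigr => h _ /=.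
  rewrite mcoeffD mcoeffZ free_coefDr coefD coefZ monalgUD.
  by rewrite monalgUZ.
- pose A := (msupp x `|` msupp ('X *: x))%fset.
  have sx : (msupp x `<=` A)%fset by rewrite fsubsetUl.
  have sz : (msupp ('X *: x)%R `<=` A)%fset by rewrite fsubsetUr.
  apply: etrans (@free_actionE _ v n _ _ sz (fsubset_refl _)) _.
  have -> : mul_lambda (free_action t F x v) n = \sum_(g <- A)
      \sum_(h <- msupp v)
        << (free_coef x@_g v@_h (F g h) * 'X)`_n *g t g h >>.
    case: n => [|n] /=.
      by rewrite big1 // => g _; rewrite big1 // => h _;
         rewrite coefMX monalgU0.
    rewrite (@free_actionE x v n _ _ sx (fsubset_refl _)).
    by apply: eq_bigr => g _; apply: eq_bigr => h _; rewrite coefMX.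
  rewrite -sumrN; apply: eq_bigr => g _; rewrite -sumrN.
  by apply: eq_bigr => h _; rewrite mcoeffZ free_coefXl coefN monalgUN.
- pose B := (msupp v `|` msupp ('X *: v))%fset.
  have sv : (msupp v `<=` B)%fset by rewrite fsubsetUl.
  have sz : (msupp ('X *: v)%R `<=` B)%fset by rewrite fsubsetUr.
  apply: (eq_lin (@free_actionE x _ n _ _ (fsubset_refl _) sz)
    (@free_actionE x v n _ _ (fsubset_refl _) sv) erefl).
  have -> : mul_lambda (free_action t F x v) n = \sum_(g <- msupp x)
      \sum_(h <- B)
        << (free_coef x@_g v@_h (F g h) * 'X)`_n *g t g h >>.
    case: n => [|n] /=.
      by rewrite big1 // => g _; rewrite big1 // => h _;
         rewrite coefMX monalgU0.
    rewrite (@free_actionE x v n _ _ (fsubset_refl _) sv).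
    by apply: eq_bigr => g _; apply: eq_bigr => h _; rewrite coefMX.
  rewrite scaler_sumr -big_split; apply: eq_bigr => g _ /=.
  rewrite scaler_sumr -big_split; apply: eq_bigr => h _ /=.
  by rewrite mcoeffZ free_coefXr coefD coefZ monalgUD monalgUZ.
Qed.

End OneAction.

Lemma bracket_act_linl (R V : lmodType {poly K}) (act : R -> V -> lpoly V)
    (c : K) (p q r : lpoly R) v m n :
  sesquilinear act -> (forall k, r@_k = c%:P *: p@_k + q@_k) ->
  bracket_act act r v m n =
  c%:P *: bracket_act act p v m n + bracket_act act q v m n.
Proof.
move=> sq E; rewrite /bracket_act scaler_sumr -big_split /=.
apply: eq_bigr => k _.
by rewrite E (sesq_linearl sq) mulrnDl scalerMnr.
Qed.

Lemma bracket_act_linr (R V : lmodType {poly K}) (act : R -> V -> lpoly V)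
    (c : K) (p : lpoly R) v w m n :
  sesquilinear act ->
  bracket_act act p (c%:P *: v + w) m n =
  c%:P *: bracket_act act p v m n + bracket_act act p w m n.
Proof.
move=> sq; rewrite /bracket_act scaler_sumr -big_split /=.
apply: eq_bigr => k _.
by rewrite (sesq_linearr sq) mulrnDl scalerMnr.
Qed.

Definition shiftl (V : zmodType) (s : nat -> nat -> V) m n :=
  if m is k.+1 then s k n else 0.
Definition shiftr (V : zmodType) (s : nat -> nat -> V) m n :=
  if n is k.+1 then s m k else 0.

Lemma sesq0l (R V : lmodType {poly K}) (act : R -> V -> lpoly V) v :
  sesquilinear act -> act 0 v = 0.
Proof.
move=> sq; apply/malgP => n; have := sesq_linearl sq 0 0 0 v n.
rewrite polyC0 !scale0r !add0r => E.
have := sesq_linearl sq 1 0 0 v n.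
rewrite polyC1 !scale1r addr0 mcoeff0 => /(congr1 (fun u => u - (act 0 v)@_n)).
by rewrite subrr addrK.
Qed.

Lemma sesq0r (R V : lmodType {poly K}) (act : R -> V -> lpoly V) x :
  sesquilinear act -> act x 0 = 0.
Proof.
move=> sq; apply/malgP => n; have := sesq_linearr sq 1 x 0 0 n.
rewrite polyC1 !scale1r addr0 mcoeff0 => /(congr1 (fun u => u - (act x 0)@_n)).
by rewrite subrr addrK.
Qed.

Lemma sesqZl (R V : lmodType {poly K}) (act : R -> V -> lpoly V) c x v n :
  sesquilinear act -> (act (c%:P *: x) v)@_n = c%:P *: (act x v)@_n.
Proof.
move=> sq; have := sesq_linearl sq c x 0 v n.
by rewrite addr0 sesq0l // mcoeff0 addr0.
Qed.

Lemma sesqZr (R V : lmodType {poly K}) (act : R -> V -> lpoly V) c x v n :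
  sesquilinear act -> (act x (c%:P *: v))@_n = c%:P *: (act x v)@_n.
Proof.
move=> sq; have := sesq_linearr sq c x v 0 n.
by rewrite addr0 sesq0r // mcoeff0 addr0.
Qed.

Lemma sesqNl (R V : lmodType {poly K}) (act : R -> V -> lpoly V) x v n :
  sesquilinear act -> (act (- x) v)@_n = - (act x v)@_n.
Proof.
move=> sq; have := sesq_linearl sq (-1) x 0 v n.
by rewrite polyCN polyC1 !scaleN1r addr0 sesq0l // mcoeff0 addr0.
Qed.

Lemma sesqNr (R V : lmodType {poly K}) (act : R -> V -> lpoly V) x v n :
  sesquilinear act -> (act x (- v))@_n = - (act x v)@_n.
Proof.
move=> sq; have := sesq_linearr sq (-1) x v 0 n.
by rewrite polyCN polyC1 !scaleN1r addr0 sesq0r // mcoeff0 addr0.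
Qed.

Lemma sesqDl (R V : lmodType {poly K}) (act : R -> V -> lpoly V) x y v n :
  sesquilinear act -> (act (x + y) v)@_n = (act x v)@_n + (act y v)@_n.
Proof.
by move=> sq; have := sesq_linearl sq 1 x y v n; rewrite polyC1 !scale1r.
Qed.

Lemma sesqDr (R V : lmodType {poly K}) (act : R -> V -> lpoly V) x v w n :
  sesquilinear act -> (act x (v + w))@_n = (act x v)@_n + (act x w)@_n.
Proof.
by move=> sq; have := sesq_linearr sq 1 x v w n; rewrite polyC1 !scale1r.
Qed.

Lemma bracket_act_derr (R V : lmodType {poly K}) (act : R -> V -> lpoly V)
    (p : lpoly R) v m n : sesquilinear act ->
  bracket_act act p ('X *: v) m n =
  'X *: bracket_act act p v m n + shiftl (bracket_act act p v) m n
  + shiftr (bracket_act act p v) m n.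
Proof.
move=> sq; rewrite /bracket_act.
have -> : shiftl (fun m0 n0 => \sum_(k < m0.+1)
    (act p@_(k : nat) v)@_(m0 - k + n0)%N *+ 'C(m0 - k + n0, n0)) m n =
  \sum_(k < m.+1) mul_lambda (act p@_(k : nat) v) (m - k + n)%N *+
     'C((m - k + n).-1, n) *+ (0 < m - k + n)%N.
  case: m => [|m] /=.
    by rewrite big_ord1 subnn add0n; case: n => //= n; rewrite bin_small.
  rewrite [RHS]big_ord_recr /= subnn add0n.
  rewrite [X in _ = _ + X](_ : _ = 0) ?addr0; last first.
    by case: n => //= n; rewrite bin_small.
  apply: eq_bigr => k _.
  by rewrite subSn -1?ltnS // addSn /= mulr1n.
have -> : shiftr (fun m0 n0 => \sum_(k < m0.+1)
    (act p@_(k : nat) v)@_(m0 - k + n0)%N *+ 'C(m0 - k + n0, n0)) m n =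
  \sum_(k < m.+1) mul_lambda (act p@_(k : nat) v) (m - k + n)%N *+
     'C((m - k + n).-1, n.-1) *+ (0 < n)%N.
  case: n => [|n] /=; first by rewrite big1.
  by apply: eq_bigr => k _; rewrite addnS /= mulr1n.
rewrite scaler_sumr -!big_split /=; apply: eq_bigr => k _.
rewrite (sesq_derr sq) mulrnDl scalerMnr -addrA; congr (_ + _).
case: n => [|n] /=.
  by rewrite !bin0 mulr0n addr0; case: (m - k + 0)%N => //=.
by rewrite addnS /= binS mulrnDr.
Qed.

Lemma bracket_act_derl (R V : lmodType {poly K}) (act : R -> V -> lpoly V)
    (p q : lpoly R) v m n : sesquilinear act ->
  (forall k, p@_k = - mul_lambda q k) ->
  bracket_act act p v m n = - shiftl (bracket_act act q v) m n.
Proof.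
move=> sq E; rewrite /bracket_act.
rewrite big_ord_recl E /= oppr0 sesq0l // mcoeff0 mul0rn add0r.
case: m => [|m] /=; first by rewrite big_ord0 oppr0.
rewrite -sumrN; apply: eq_bigr => k _.
by rewrite /bump /= add1n E /= sesqNl // subSS mulNrn.
Qed.

Lemma bracket_act_derm (R V : lmodType {poly K}) (act : R -> V -> lpoly V)
    (p q : lpoly R) v m n : sesquilinear act ->
  (forall k, p@_k = 'X *: q@_k + mul_lambda q k) ->
  bracket_act act p v m n = - shiftr (bracket_act act q v) m n.
Proof.
move=> sq E.
have -> : bracket_act act p v m n =
  \sum_(k < m.+1) (act ('X *: q@_(k : nat)) v)@_(m - k + n)%N *+
     'C(m - k + n, n) + shiftl (bracket_act act q v) m n.
  rewrite /bracket_act [LHS](eq_bigr (fun k : 'I_m.+1 =>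
      (act ('X *: q@_(k : nat)) v)@_(m - k + n)%N *+ 'C(m - k + n, n)
      + (act (mul_lambda q k) v)@_(m - k + n)%N *+ 'C(m - k + n, n))); last first.
    by move=> k _; rewrite E sesqDl // mulrnDl.
  rewrite big_split /=; congr (_ + _).
  rewrite big_ord_recl /= sesq0l // mcoeff0 mul0rn add0r.
  by case: m => [|m] /=; rewrite ?big_ord0.
rewrite /bracket_act.
have -> : shiftl (fun m0 n0 => \sum_(k < m0.+1)
    (act q@_(k : nat) v)@_(m0 - k + n0)%N *+ 'C(m0 - k + n0, n0)) m n =
  \sum_(k < m.+1) mul_lambda (act q@_(k : nat) v) (m - k + n)%N *+
     'C((m - k + n).-1, n) *+ (0 < m - k + n)%N.
  case: m => [|m] /=.
    by rewrite big_ord1 subnn add0n; case: n => //= n; rewrite bin_small.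
  rewrite [RHS]big_ord_recr /= subnn add0n.
  rewrite [X in _ = _ + X](_ : _ = 0) ?addr0; last first.
    by case: n => //= n; rewrite bin_small.
  apply: eq_bigr => k _.
  by rewrite subSn -1?ltnS // addSn /= mulr1n.
have -> : shiftr (fun m0 n0 => \sum_(k < m0.+1)
    (act q@_(k : nat) v)@_(m0 - k + n0)%N *+ 'C(m0 - k + n0, n0)) m n =
  \sum_(k < m.+1) mul_lambda (act q@_(k : nat) v) (m - k + n)%N *+
     'C((m - k + n).-1, n.-1) *+ (0 < n)%N.
  case: n => [|n] /=; first by rewrite big1.
  by apply: eq_bigr => k _; rewrite addnS /= mulr1n.
rewrite -big_split -sumrN /=; apply: eq_bigr => k _.
rewrite (sesq_derl sq) mulNrn.
case: n => [|n] /=.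
  by rewrite !bin0 mulr0n oppr0; case: (m - k + 0)%N => [|l] /=;
     rewrite ?oppr0 ?mul0rn ?addr0 // mulr1n addNr.
by rewrite addnS /= binS mulrnDr mulr1n opprD addrAC addNr add0r.
Qed.

Definition skew_bound (V : lmodType {poly K}) (p : lpoly V) N n : V :=
  \sum_(m < N) (((-1) ^+ m * 'X^(m - n)) *+ 'C(m, n)) *: p@_(m : nat).

Lemma skew_boundE (V : lmodType {poly K}) (p : lpoly V) N n :
  (forall m, (N <= m)%N -> p@_m = 0) -> skew_subst p n = skew_bound p N n.
Proof.
move=> p0; rewrite /skew_subst /skew_bound.
pose B := seq_fset tt (iota 0 N).
rewrite (@big_fset_incl _ _ _ _ _ B); first last.
- by move=> m _ /mcoeff_outdom ->; rewrite scaler0.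
- apply/fsubsetP => m m_in; rewrite seq_fsetE mem_iota add0n /=.
  by rewrite ltnNge; apply: contraL m_in => /p0; rewrite -mcoeff_eq0 => /eqP.
rewrite (perm_big (iota 0 N)); last first.
  by apply: uniq_perm; rewrite ?fset_uniq ?iota_uniq // => i; rewrite seq_fsetE.
by rewrite -[X in iota 0 X]subn0 -/(index_iota 0 N) big_mkord.
Qed.

Lemma skew_lin (V : lmodType {poly K}) (c : {poly K}) (p q r : lpoly V) n :
  (forall k, r@_k = c *: p@_k + q@_k) ->
  skew_subst r n = c *: skew_subst p n + skew_subst q n.
Proof.
move=> E; have [N1 h1] := lpoly_bound p; have [N2 h2] := lpoly_bound q.
pose N := maxn N1 N2.
have h1' m : (N <= m)%N -> p@_m = 0 by rewrite geq_max => /andP[/h1].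
have h2' m : (N <= m)%N -> q@_m = 0 by rewrite geq_max => /andP[_ /h2].
have h3 m : (N <= m)%N -> r@_m = 0.
  by move=> h; rewrite E h1' // h2' // scaler0 addr0.
rewrite (skew_boundE _ h1') (skew_boundE _ h2') (skew_boundE _ h3).
rewrite /skew_bound scaler_sumr -big_split; apply: eq_bigr => k _ /=.
by rewrite E scalerDr !scalerA mulrC.
Qed.

Definition shift (V : zmodType) (s : nat -> V) n := if n is k.+1 then s k else 0.

Lemma skew_mul (V : lmodType {poly K}) (p q : lpoly V) n :
  (forall k, p@_k = mul_lambda q k) ->
  skew_subst p n = - ('X *: skew_subst q n) - shift (skew_subst q) n.
Proof.
move=> E; have [N h] := lpoly_bound q.
have h' m : (N.+1 <= m)%N -> p@_m = 0 by case: m => // m /h; rewrite E.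
rewrite (skew_boundE _ h') (skew_boundE _ h).
have -> : shift (skew_subst q) n = shift (skew_bound q N) n.
  by case: n => //= n; apply: skew_boundE.
rewrite /skew_bound big_ord_recl E /= scaler0 add0r.
have -> : shift (fun n0 => \sum_(m < N)
     (((-1) ^+ m * 'X^(m - n0)) *+ 'C(m, n0)) *: q@_(m : nat)) n =
   \sum_(m < N) (((-1) ^+ m * 'X^(m.+1 - n)) *+ 'C(m, n.-1) *+ (0 < n)%N)
       *: q@_(m : nat).
  case: n => [|n] /=; first by rewrite big1 // => i _; rewrite scale0r.
  by apply: eq_bigr => k _; rewrite subSS.
rewrite scaler_sumr -!sumrN -big_split /=; apply: eq_bigr => k _.
rewrite /bump /= add1n E /= scalerA -!scaleNr -scalerDl; congr (_ *: _).
case: n => [|n] /=.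
  by rewrite !bin0 mulr0n subr0 !mulr1n !subn0 !exprS; ring.
rewrite binS mulr1n subSS mulrnDr exprS mulN1r mulNr !mulNrn.
congr (- _ - _); have [lt_nk|le_kn] := ltnP n k.
  by rewrite -(subnSK lt_nk) exprS mulrCA mulrnAr.
by rewrite !bin_small ?ltnS // !mulr0n mulr0.
Qed.

Definition der_poly (V : lmodType {poly K}) (p : lpoly V) : lpoly V :=
  [malg k in msupp p => 'X *: p@_k].

Lemma der_polyE (V : lmodType {poly K}) (p : lpoly V) k :
  (der_poly p)@_k = 'X *: p@_k.
Proof. by rewrite mcoeffE; case: msuppP; rewrite ?scaler0. Qed.

(* lambda + del becomes - lambda *)
Lemma skew_derr (V : lmodType {poly K}) (p q : lpoly V) n :
  (forall k, p@_k = 'X *: q@_k + mul_lambda q k) ->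
  skew_subst p n = - shift (skew_subst q) n.
Proof.
move=> E.
have E1 k : p@_k = 'X *: q@_k + (p - der_poly q)@_k.
  by rewrite mcoeffB der_polyE addrC subrK.
rewrite (skew_lin _ E1) (@skew_mul _ (p - der_poly q) q) ?addrA ?subrr ?add0r //.
by move=> k; rewrite mcoeffB der_polyE E addrC addKr.
Qed.

Lemma skew_derl (V : lmodType {poly K}) (p q : lpoly V) n :
  (forall k, p@_k = - mul_lambda q k) ->
  skew_subst p n = 'X *: skew_subst q n + shift (skew_subst q) n.
Proof.
move=> E; have := @skew_mul _ (- p) q n.
have -> : skew_subst (- p) n = - skew_subst p n.
  rewrite /skew_subst msuppN -sumrN; apply: eq_bigr => k _.
  by rewrite mcoeffN scalerN.
move=> h; rewrite -[LHS]opprK h ?opprD ?opprK //.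
by move=> k; rewrite mcoeffN E opprK.
Qed.

Section Extend.
Context (G : choiceType).
Local Notation E := {malg {poly K}[G]}.
Local Notation e g := (<< 1 *g g >> : E).
Context (br : E -> E -> lpoly E).
Hypothesis sq : sesquilinear br.

Lemma skew_extend :
  (forall g h n, (br (e g) (e h))@_n = - skew_subst (br (e h) (e g)) n) ->
  forall x y n, (br x y)@_n = - skew_subst (br y x) n.
Proof.
have skew0 n : skew_subst (0 : lpoly E) n = 0.
  by rewrite /skew_subst msupp0 big_seq_fset0.
move=> gen x; elim/(@free_ind G): x => [|c x x' IH IH'|x IH|g] y n.
- by rewrite sesq0l // sesq0r // skew0 mcoeff0 oppr0.
- rewrite (sesq_linearl sq) IH IH' (skew_lin _ (sesq_linearr sq c y x x')).
  by rewrite opprD scalerN.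
- rewrite (sesq_derl sq) (skew_derr _ (sesq_derr sq y x)) opprK.
  by case: n => [|n] /=; rewrite ?oppr0 // IH opprK.
elim/(@free_ind G): y n => [|c y y' IH IH'|y IH|h] n.
- by rewrite sesq0l // sesq0r // skew0 mcoeff0 oppr0.
- rewrite (sesq_linearr sq) IH IH' (skew_lin _ (sesq_linearl sq c y y' (e g))).
  by rewrite opprD scalerN.
- rewrite (sesq_derr sq) (skew_derl _ (sesq_derl sq y (e g))) opprD IH scalerN.
  by case: n => [|n] /=; rewrite ?oppr0 // IH.
exact: gen.
Qed.

Lemma jacobi_extend :
  (forall g h k m n,
    (br (e g) (br (e h) (e k))@_n)@_m - (br (e h) (br (e g) (e k))@_m)@_n
    = bracket_act br (br (e g) (e h)) (e k) m n) ->
  action_law br br.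
Proof.
have act0 (p : lpoly E) m n : bracket_act br p 0 m n = 0.
  by rewrite /bracket_act big1 // => k _; rewrite sesq0r // mcoeff0 mul0rn.
have act0' v m n : bracket_act br 0 v m n = 0.
  by rewrite /bracket_act big1 // => k _; rewrite mcoeff0 sesq0l // mcoeff0 mul0rn.
have lin1 (c : K) (a b a' b' : E) :
    c%:P *: a + b - (c%:P *: a' + b') = c%:P *: (a - a') + (b - b').
  by rewrite scalerBr opprD addrACA.
move=> gen x; elim/(@free_ind G): x => [|c x x' IH IH'|x IH|g] y v m n.
- by rewrite !sesq0l // !mcoeff0 sesq0r // mcoeff0 subr0 act0'.
- rewrite !(sesq_linearl sq) (sesq_linearr sq) lin1 IH IH'.
  by rewrite (bracket_act_linl _ _ _ sq (sesq_linearl sq c x x' y)).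
- rewrite (bracket_act_derl _ _ _ sq (sesq_derl sq x y)).
  rewrite !(sesq_derl sq) sesqNr // -opprD; congr (- _).
  case: m => [|m] /=; last by rewrite -IH.
  by rewrite sesq0r // mcoeff0 subr0.
elim/(@free_ind G): y v m n => [|c y y' IH IH'|y IH|h] v m n.
- by rewrite !(sesq0l _ sq) !(sesq0r _ sq) !mcoeff0 !(sesq0r _ sq) mcoeff0 act0' subrr.
- rewrite !(sesq_linearl sq) (sesq_linearr sq) lin1 IH IH'.
  by rewrite (bracket_act_linl _ _ _ sq (sesq_linearr sq c (e g) y y')).
- rewrite (bracket_act_derm _ _ _ sq (sesq_derr sq (e g) y)).
  rewrite !(sesq_derl sq) sesqNr // -opprD; congr (- _).
  case: n => [|n] /=; last by rewrite -IH.
  by rewrite sesq0r // mcoeff0 subr0.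
elim/(@free_ind G): v m n => [|c v v' IH IH'|v IH|k] m n.
- by rewrite !(sesq0r _ sq) !mcoeff0 !(sesq0r _ sq) !mcoeff0 act0 subrr.
- rewrite !(sesq_linearr sq) lin1 IH IH'.
  by rewrite (bracket_act_linr _ _ _ _ _ _ sq).
- rewrite (bracket_act_derr _ _ _ _ sq) -IH.
  rewrite !(sesq_derr sq) !sesqDr // !(sesq_derr sq) scalerBr.
  have -> : shiftl (bracket_act br (br (e g) (e h)) v) m n =
     mul_lambda (br (e g) (br (e h) v)@_n) m
     - (br (e h) (mul_lambda (br (e g) v) m))@_n.
    by case: m => [|m] /=; rewrite -?IH // sesq0r // mcoeff0 subrr.
  have -> : shiftr (bracket_act br (br (e g) (e h)) v) m n =
     (br (e g) (mul_lambda (br (e h) v) n))@_m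
     - mul_lambda (br (e h) (br (e g) v)@_m) n.
    by case: n => [|n] /=; rewrite -?IH // sesq0r // mcoeff0 subrr.
  by rewrite [X in _ - X]addrAC !opprD addrACA; congr (_ + _); rewrite addrACA.
exact: gen.
Qed.
End Extend.
End FreeAction.

Section CHV.
Context {K : fieldType} (a b : K).
Local Notation E := {malg {poly K}[chv_index]}.
Local Notation e g := (<< 1 *g (g : chv_index) >> : E).

(* the coefficient of lambda^n in [chv_coef a b g h] is
   [(chv_u g h n) del + chv_c g h n] *)
Definition chv_u (g h : chv_index) (n : nat) : K :=
  match g, h, n with
  | inl _, inl _, 0%N => 1
  | inl _, inr _, 0%N => 1
  | inr _, inl _, 0%N => a - 1
  | _, _, _ => 0
  end.
Definition chv_c (g h : chv_index) (n : nat) : K :=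
  match g, h, n with
  | inl _, inl _, 1%N => 2
  | inl _, inr _, 0%N => b
  | inl _, inr _, 1%N => a
  | inr _, inl _, 0%N => - b
  | inr _, inl _, 1%N => a
  | _, _, _ => 0
  end.
Definition chv_co g h n : {poly K} :=
  (chv_u g h n)%:P * 'X + (chv_c g h n)%:P.

Lemma chv_coefE g h n : (chv_coef a b g h)`_n = chv_co g h n.
Proof.
rewrite /chv_co; case: g h => [i|i] [j|j]; case: n => [|[|n]] //=;
  rewrite /pd /plam /pcst ?(coef0, coefD, coefN, coefCM, coefC, coefMC, coefX) /=
    ?(polyC0, polyC1, polyCN, polyCB); ring.
Qed.

Section Generators.
Context (br : E -> E -> lpoly E).
Hypothesis chv_sesq : sesquilinear br.
Hypothesis chv_gen : forall g h n,
  (br (e g) (e h))@_n = << chv_co g h n *g chv_target g h >>.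

Lemma malg_lin (u c : K) (g : chv_index) :
  << u%:P * 'X + c%:P *g g >> = u%:P *: ('X *: e g) + c%:P *: e g.
Proof. by rewrite monalgUD scalerA !monalgUZ !mulr1. Qed.

Definition co_shift g h m := if m is k.+1 then chv_co g h k else 0.

Lemma chv_genr g (u c : K) h m :
  (br (e g) << u%:P * 'X + c%:P *g h >>)@_m =
  << u%:P * ('X * chv_co g h m + co_shift g h m) + c%:P * chv_co g h m
     *g chv_target g h >>.
Proof.
rewrite malg_lin (sesq_linearr chv_sesq) (sesq_derr chv_sesq).
rewrite (sesqZr _ _ _ _ chv_sesq) chv_gen [RHS]monalgUD -(monalgUZ u%:P)
  [in RHS]monalgUD.
rewrite -(monalgUZ c%:P) -(monalgUZ 'X).
by case: m => [|m] /=; rewrite ?chv_gen ?monalgU0.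
Qed.

Lemma chv_genl g (u c : K) h m :
  (br << u%:P * 'X + c%:P *g g >> (e h))@_m =
  << - (u%:P * co_shift g h m) + c%:P * chv_co g h m *g chv_target g h >>.
Proof.
rewrite malg_lin (sesq_linearl chv_sesq) (sesq_derl chv_sesq).
rewrite (sesqZl _ _ _ _ chv_sesq) chv_gen [RHS]monalgUD -mulrN.
rewrite -(monalgUZ u%:P) -(monalgUZ c%:P) monalgUN.
by case: m => [|m] /=; rewrite ?chv_gen ?monalgU0.
Qed.

Lemma chv_targetC g h : chv_target g h = chv_target h g.
Proof. by case: g h => [i|i] [j|j] /=; rewrite addrC. Qed.

Lemma chv_targetA g h k :
  chv_target g (chv_target h k) = chv_target (chv_target g h) k.
Proof. by case: g h k => [i|i] [j|j] [k|k] /=; rewrite addrA. Qed.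

Lemma chv_co_big g h n : chv_co g h n.+2 = 0.
Proof. by rewrite /chv_co; case: g h => [i|i] [j|j] /=; rewrite mul0r addr0. Qed.

Lemma chv_skew x y n : (br x y)@_n = - skew_subst (br y x) n.
Proof.
apply: (skew_extend chv_sesq) => {n x y}g h n.
rewrite (@skew_boundE _ _ _ 2); last first.
  by case=> [|[|m]] // _; rewrite chv_gen chv_co_big monalgU0.
rewrite /skew_bound !big_ord_recl big_ord0 addr0 /= !chv_gen (chv_targetC h g).
rewrite !monalgUZ -monalgUD -monalgUN; congr << _ *g _ >>.
rewrite /bump /= /chv_co.
case: g h => [i|i] [j|j]; case: n => [|[|n]] /=;
  rewrite ?polyC0 ?polyC1 ?polyCN ?polyCB ?bin0 ?mulr1n ?mulr0n ?subn0 ?subnn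
    ?expr0 ?expr1; ring.
Qed.

Lemma bracket_act2 g h k m n :
  bracket_act br (br (e g) (e h)) (e k) m n =
  (br (br (e g) (e h))@_0 (e k))@_(m + n)%N *+ 'C(m + n, n)
  + (if m is l.+1 then
       (br (br (e g) (e h))@_1 (e k))@_(l + n)%N *+ 'C(l + n, n) else 0).
Proof.
rewrite /bracket_act big_ord_recl /= subn0; congr (_ + _).
case: m => [|l]; first by rewrite big_ord0.
rewrite big_ord_recl /= /bump /= subSS subn0 big1 ?addr0 // => i _.
rewrite /= chv_gen chv_co_big monalgU0 sesq0l; last exact: chv_sesq.
by rewrite mcoeff0 mul0rn.
Qed.

Lemma chv_jacobi : action_law br br.
Proof.
apply: (jacobi_extend chv_sesq) => g h k m n.
rewrite bracket_act2 !chv_gen !chv_genr !chv_genl.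
have -> : (if m is l.+1 then
   (br << chv_co g h 1 *g chv_target g h >> (e k))@_(l + n)%N *+ 'C(l + n, n)
   else 0) = << if m is l.+1 then
   (- ((chv_u g h 1)%:P * co_shift (chv_target g h) k (l + n)%N)
    + (chv_c g h 1)%:P * chv_co (chv_target g h) k (l + n)%N)
     *+ 'C(l + n, n) else 0 *g chv_target (chv_target g h) k >>.
  by case: m => [|l]; rewrite ?monalgU0 // chv_genl monalgUMn.
rewrite -chv_targetA [chv_target h (chv_target g k)]chv_targetA.
rewrite [chv_target h g]chv_targetC -chv_targetA.
rewrite -monalgUMn -monalgUB -monalgUD; congr << _ *g _ >>.
rewrite /chv_co /co_shift /chv_co.
case: g h k => [i|i] [j|j] [k|k];
  case: m => [|[|[|m]]]; case: n => [|[|[|n]]];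
  rewrite /= ?addn0 ?addn1 ?addn2 ?addnS ?addSn ?add0n /=
   ?polyC0 ?polyC1 ?polyCN ?polyCB ?polyCD ?mul0r ?mulr0 ?add0r ?addr0 ?oppr0
   ?mul0rn ?mulr0 ?addr0 //;
  rewrite ?bin0 ?binn ?bin1 ?mulr1n; try ring.
Qed.

End Generators.

Lemma chv_is_lie_conformal : is_lie_conformal (chv_bracket a b).
Proof.
have sq : sesquilinear (chv_bracket a b) by apply: free_action_sesquilinear.
have gen g h n : (chv_bracket a b (e g) (e h))@_n =
    << chv_co g h n *g chv_target g h >>.
  by rewrite -chv_coefE; apply: free_action_gen.
split; [exact: sq | exact: chv_skew | exact: chv_jacobi].
Qed.

End CHV.

Definition CHV (K : fieldType) (a b : K) : lieConformalAlg K :=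
  LieConformalAlg (chv_is_lie_conformal a b).

Definition chv_grading (K : fieldType) (a b : K) (i : int) (x : CHV a b) : Prop :=
  exists p q : {poly K}, x = p *: chvL K i + q *: chvM K i.

(* The free K[del]-module with basis v_m = << 1 *g m >>, where
   L_i_lambda v_m = FL i m (del, lambda) v_(i + m) and
   M_i_lambda v_m = d v_(i + m).
   This is a lambda-action only: the module axioms are not claimed, and they
   do fail for [series_VAd] when d <> 0 and A is not constant. *)
Definition series_carrier (K : fieldType) : lmodType {poly K} :=
  {malg {poly K}[int]}.

Definition series_target (g : chv_index) (m : int) : int :=
  match g with inl i | inr i => i + m end.

Definition series_coef (K : fieldType) (FL : int -> int -> {poly {poly K}})
    (d : K) (g : chv_index) (m : int) : {poly {poly K}} :=
  match g with inl i => FL i m | inr _ => pcst d end.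

Definition series_action (K : fieldType) (FL : int -> int -> {poly {poly K}})
    (d : K) : chv_carrier K -> series_carrier K -> lpoly (series_carrier K) :=
  free_action series_target (series_coef FL d).

Definition coef_alpha (K : fieldType) (alpha beta : K) (i m : int) :
    {poly {poly K}} :=
  pd K + pcst alpha * plam K + pcst beta.

(* The sequence A in {0,1}^infty is given by booleans, [true] standing for 1. *)
Definition coef_A (K : fieldType) (A : int -> bool) (beta : K) (i m : int) :
    {poly {poly K}} :=
  match A m, A (i + m) with
  | false, false => pd K + pcst beta
  | true, true => pd K + pcst beta + plam K
  | false, true => 1
  | true, false => (pd K + pcst beta) * (pd K + pcst beta + plam K)
  end.

Definition series_Vd (K : fieldType) (alpha beta d : K) :=
  series_action (coef_alpha alpha beta) d.
Definition series_VAd (K : fieldType) (A : int -> bool) (beta d : K) :=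
  series_action (coef_A A beta) d.
Definition series_V (K : fieldType) (alpha beta : K) := series_Vd alpha beta 0.
Definition series_VA (K : fieldType) (A : int -> bool) (beta : K) :=
  series_VAd A beta 0.

(* Main.v *)
Require Import Defs.
From HB Require Import structures.
From mathcomp Require Import all_boot all_order all_algebra finmap complex reals.
From mathcomp Require Import monalg.
From mathcomp Require Import ring.
From mathcomp Require boolp.
Import GRing.Theory Num.Theory.
Local Open Scope ring_scope.
Set Implicit Arguments.
Unset Strict Implicit.
Unset Printing Implicit Defensive.

(** Choose a generator [w m] of each homogeneous component.  The action of a
    basis element [h] of CHV(a,b), which is some L_i or M_i, is then
    [h_lambda w_m = F_(h,m)(del, lambda) w_(i+m)] for polynomials [F h m], and
    the module axiom becomes one functional equation between them
    ([structure_law], obtained in [module_structure_law]).  Since the base field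
    is infinite, such polynomials can be handled as functions of two scalars,
    and what remains is to solve that equation.

    Write f_(i,m) and g_(i,m) for the polynomials of L_i and M_i.  With i = 0
    the equation says that f_(j,m) intertwines the Virasoro modules of L_0 on
    components m and j + m.  Its value at lambda = 0 forces f_(0,m) to have
    constant term del + beta in lambda as soon as some f_(j,m) is nonzero
    ([intertwines_degree0]); its first derivative at lambda = 0 is an Euler
    equation ([intertwines_euler]).  Hence f_(0,m) = del + alpha_m lambda + beta
    ([weight_density]), and f_(j,m) is homogeneous in del + beta and lambda, of
    degree 1 + alpha_m - alpha_(j+m) ([density_intertwiners]).  The equation for
    the pair L_i, L_(-i) shows that no f_(i,m) vanishes ([virasoro_neq0]), so
    beta does not depend on m, and the degrees of f_(i,m) and f_(-i,i+m), which
    add up to 2, all lie in {0, 1, 2}.  A nonzero intertwiner of degree 2 exists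
    only from weight 1 to weight 0 ([intertwiner_le2]).  Therefore either alpha_m
    is constant or alpha_m is a sequence of zeros and ones
    ([weight_dichotomy]), and every f_(i,m) is a nonzero scalar c_(i,m) times the
    polynomial of the model.  These scalars satisfy
    c_(j,m) c_(i,j+m) = c_(i+j,m) ([scale_cocycle]), so replacing w_m by
    c_(m,0) w_m removes them.

    For the M_i: commutativity of M_0 with itself, by a comparison of degrees,
    makes g_(0,m) independent of del ([del_free_of_MM]); bracketing with L_0
    then makes it a constant, zero unless a = 1 and b = 0 ([M0_const]), and
    bracketing with L_i shows that this constant d is the same for all m and
    determines every g_(i,m) ([M_classified]).  If d is nonzero, all g_(i,m) are
    independent of del, which excludes the intertwiners of degree 2; so the
    weights alpha_m are then constant. *)

(** * Polynomials in del and lambda as functions *)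

(** Closes an identity that holds modulo one known equation, the cofactor being
    given by hand. *)
Lemma lin_comb (R : pzRingType) (k a b c d : R) :
  c = d -> a - b = k * (c - d) -> a = b.
Proof. by move=> ->; rewrite subrr mulr0 => /eqP; rewrite subr_eq0 => /eqP. Qed.

Section Evaluation.
Context {K : numFieldType}.
Implicit Types (p : {poly K}) (F : {poly {poly K}}) (x u : K).

(** The value at del = [x] and lambda = [u]. *)
Definition ev F x u : K := F.[u%:P].[x].

Lemma poly_fun_eq0 p : (forall x, p.[x] = 0) -> p = 0.
Proof.
(* A field of characteristic 0 contains size p distinct roots 0, 1, 2, ... *)
move=> p0; apply: (@roots_geq_poly_eq0 _ p [seq n%:R | n <- iota 0 (size p)]).
- by apply/allP => _ /mapP[n _ ->]; apply/rootP; apply: p0.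
- by rewrite map_inj_uniq ?iota_uniq // => m n /eqP; rewrite eqr_nat => /eqP.
- by rewrite size_map size_iota.
Qed.

Lemma poly_fun_inj p q : (forall x, p.[x] = q.[x]) -> p = q.
Proof.
move=> E; apply/eqP; rewrite -subr_eq0; apply/eqP/poly_fun_eq0 => x.
by rewrite hornerD hornerN E subrr.
Qed.

(** Exchanges the roles of the two variables: the polynomial in lambda obtained
    by giving del the value [x]. *)
Definition at_del x F : {poly K} := map_poly (horner_eval x) F.

Lemma horner_at_del x F u : (at_del x F).[u] = ev F x u.
Proof.
apply: etrans (horner_map (horner_eval x) F u%:P).
by congr _.[_]; apply/esym/hornerC.
Qed.

Lemma coef_at_del x F n : (at_del x F)`_n = (F`_n).[x].
Proof. by rewrite coef_map. Qed.

Lemma ev_eq0 F : (forall x u, ev F x u = 0) -> F = 0.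
Proof.
move=> F0; apply/polyP => n; rewrite coef0; apply: poly_fun_eq0 => x.
rewrite -coef_at_del (_ : at_del x F = 0) ?coef0 //.
by apply: poly_fun_eq0 => u; rewrite horner_at_del.
Qed.

Lemma evD F G x u : ev (F + G) x u = ev F x u + ev G x u.
Proof. by rewrite /ev !hornerD. Qed.

Lemma evN F x u : ev (- F) x u = - ev F x u.
Proof. by rewrite /ev !hornerN. Qed.

Lemma evM F G x u : ev (F * G) x u = ev F x u * ev G x u.
Proof. by rewrite /ev !hornerM. Qed.

Lemma evC p x u : ev p%:P x u = p.[x].
Proof. by rewrite /ev hornerC. Qed.

Lemma ev_pd x u : ev (pd K) x u = x.
Proof. by rewrite evC hornerX. Qed.

Lemma ev_plam x u : ev (plam K) x u = u.
Proof. by rewrite /ev hornerX hornerC. Qed.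

Lemma ev_pcst c x u : ev (pcst c) x u = c.
Proof. by rewrite evC hornerC. Qed.

Lemma ev1 x u : ev 1 x u = 1.
Proof. by rewrite evC hornerC. Qed.

Lemma ev0 x u : ev 0 x u = 0.
Proof. by rewrite evC horner0. Qed.

Definition evE := (evD, evN, evM, ev_pd, ev_plam, ev_pcst, ev1, ev0).

(** The substitutions del -> del + lambda and del -> - lambda of sesquilinearity
    are instances. *)
Lemma ev_subst p F x u : ev (map_poly polyC p \Po F) x u = p.[ev F x u].
Proof.
elim/poly_ind: p => [|p c IH]; first by rewrite rmorph0 comp_poly0 ev0 horner0.
rewrite rmorphD rmorphM /= map_polyX map_polyC /= comp_polyD comp_polyM comp_polyX.
by rewrite comp_polyC evD evM IH evC !hornerE.
Qed.

Lemma ev_at0 F x : ev F x 0 = (F`_0).[x].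
Proof. by rewrite /ev horner_coef0. Qed.

Lemma ev_inj F G : (forall x u, ev F x u = ev G x u) -> F = G.
Proof.
move=> E; apply/eqP; rewrite -subr_eq0; apply/eqP/ev_eq0 => x u.
by rewrite evD evN E subrr.
Qed.

Lemma deriv_shift p c : (p \Po ('X + c%:P))^`() = p^`() \Po ('X + c%:P).
Proof. by rewrite deriv_comp derivD derivX derivC addr0 mulr1. Qed.

(** After the translation by [b], the coefficients of [p] satisfy
    [k p_k = s p_k], so that only one of them survives. *)
Lemma euler_ode p (s b : K) :
  (forall x, (x + b) * p^`().[x] = s * p.[x]) -> p != 0 ->
  exists2 d : nat, s = d%:R & exists2 c, c != 0 & p = c *: ('X + b%:P) ^+ d.
Proof.
move=> E p_neq0; pose q := p \Po ('X + (- b)%:P).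
have Eq : 'X * q^`() = s *: q.
  apply: poly_fun_inj => x.
  by rewrite deriv_shift !(hornerE, horner_comp) -E; ring.
have Eqn k : k%:R * q`_k = s * q`_k.
  have /polyP/(_ k) := Eq; rewrite coefXM coefZ => <-.
  by case: k => [|k]; rewrite ?mul0r //= coef_deriv mulr_natl.
have pq : p = q \Po ('X + b%:P).
  by rewrite -comp_polyA comp_polyD comp_polyX comp_polyC -addrA -polyCD subrr
             addr0 comp_polyXr.
have q_neq0 : q != 0.
  by apply: contraNneq p_neq0 => q0; rewrite pq q0 comp_poly0.
have s_deg : s = (size q).-1%:R.
  apply/esym/(mulIf (x := q`_(size q).-1)); last exact: Eqn.
  by rewrite -lead_coefE lead_coef_eq0.
exists (size q).-1 => //.
exists (lead_coef q); first by rewrite lead_coef_eq0.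
have q_mono : q = lead_coef q *: 'X^((size q).-1).
  apply/polyP => k; rewrite coefZ coefXn.
  have [->|ne_k] := eqVneq; first by rewrite mulr1 lead_coefE.
  apply/eqP; rewrite mulr0; move/eqP: (Eqn k); rewrite -subr_eq0 -mulrBl mulf_eq0.
  by rewrite s_deg subr_eq0 eqr_nat (negbTE ne_k).
by rewrite pq [in LHS]q_mono comp_polyZ rmorphXn /= comp_polyX.
Qed.

(** The derivative in del; the derivative in lambda is [F^`()]. *)
Definition dpartial F := map_poly (@deriv K) F.

Lemma coef_dpartial F n : (dpartial F)`_n = (F`_n)^`().
Proof. by rewrite coef_map_id0 ?deriv0. Qed.

Lemma ev_dpartial F x u : ev (dpartial F) x u = (F.[u%:P])^`().[x].
Proof.
rewrite /ev (horner_coef_wide _ (size_poly _ _)) (horner_coef F).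
rewrite (big_morph (@deriv K) (@derivD K) (@deriv0 K)).
congr _.[_]; apply: eq_bigr => n _.
by rewrite -/(dpartial F) coef_dpartial -rmorphXn derivM derivC mulr0 addr0.
Qed.

(** If L_0 acts on rank one modules with generators w and w' by [G] and [G'], and
    an operator L_j of the current Virasoro algebra sends w to [F w'], this is
    the module axiom for L_0 and L_j. *)
Definition intertwines (G G' F : {poly {poly K}}) := forall x l u,
  ev F (x + l) u * ev G' x l - ev G (x + u) l * ev F x u
  = (l - u) * ev F x (l + u).

(** Obtained by differentiating the intertwining equation in lambda at 0, which
    brings in only the coefficients of [G] and [G'] of degree at most 1. *)
Lemma intertwines_euler G G' F : intertwines G G' F -> forall x u,
  ev (dpartial F) x u * (G'`_0).[x] + ev F x u * (G'`_1).[x]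
    - (G`_1).[x + u] * ev F x u = ev F x u - u * ev F^`() x u.
Proof.
move=> E x u.
(* The hypothesis, as an identity between polynomials in lambda. *)
have : (F.[u%:P] \Po ('X + x%:P)) * at_del x G'
    - (ev F x u)%:P * at_del (x + u) G
    = ('X - u%:P) * (at_del x F \Po ('X + u%:P)).
  apply: poly_fun_inj => l.
  rewrite !(hornerE, horner_comp) !horner_at_del -/(ev F (l + x) u).
  by rewrite [l + x]addrC (mulrC (ev F x u)) E.
move/(congr1 (fun p => p^`().[0])).
rewrite derivB !derivM !deriv_shift derivB derivX !derivC.
rewrite !(hornerE, horner_comp) !horner_at_del -ev_dpartial !ev_at0.
have deriv_at y H : (at_del y H)^`().[0] = (H`_1).[y].
  by rewrite horner_coef0 coef_deriv mulr1n coef_at_del.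
rewrite !deriv_at /at_del deriv_map -/(at_del x F^`()) horner_at_del.
by rewrite [_ * (G`_1).[_]]mulrC => ->; ring.
Qed.

(** Euler's criterion for homogeneity in del + [b] and lambda: the coefficient
    of each power of lambda satisfies the equation of [euler_ode]. *)
Lemma euler_homogeneous F (s b : K) : F != 0 ->
  (forall x u, (x + b) * ev (dpartial F) x u + u * ev F^`() x u = s * ev F x u) ->
  exists2 k : nat, s = k%:R & exists c : nat -> K, forall x u,
    ev F x u = \sum_(n < k.+1) c n * (x + b) ^+ (k - n) * u ^+ n.
Proof.
move=> F_neq0 E.
have En n x : (x + b) * (F`_n)^`().[x] = (s - n%:R) * (F`_n).[x].
  have : ('X + b%:P)%:P * dpartial F + 'X * F^`() = s%:P%:P * F.
    apply: ev_inj => y u; rewrite !(evE, evC) !hornerE -E.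
    by congr (_ + _ * _); rewrite /ev hornerX hornerC.
  move/polyP/(_ n)/(congr1 (horner^~ x)).
  rewrite coefD !coefCM coefXM coef_dpartial.
  rewrite !hornerE mulrBl => <-.
  case: n => [|n] /=; first by rewrite horner0 mul0r subr0 addr0.
  by rewrite coef_deriv hornerMn -[_ *+ n.+1]mulr_natl addrK.
have Fn n : F`_n != 0 -> exists2 d, s = (d + n)%:R
    & exists c, F`_n = c *: ('X + b%:P) ^+ d.
  move=> /(euler_ode (En n))[d sd [c _ Fc]]; exists d; last by exists c.
  by apply/eqP; rewrite natrD -subr_eq sd.
have [k sk] : exists k : nat, s = k%:R.
  have := F_neq0; rewrite -lead_coef_eq0 lead_coefE => /Fn[d sd _].
  by exists (d + (size F).-1)%N.
exists k => //; exists (fun n => lead_coef F`_n) => x u.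
have F0 n : (k < n)%N -> F`_n = 0.
  move=> kn; apply/eqP; apply: contraLR kn => /Fn[d /eqP].
  by rewrite sk eqr_nat -leqNgt => /eqP-> _; rewrite leq_addl.
rewrite /ev (@horner_coef_wide _ k.+1 F); last by apply/leq_sizeP => n; apply: F0.
rewrite horner_sum; apply: eq_bigr => i _; move: (i : nat) => {i} n.
rewrite -rmorphXn !hornerE.
have [->|/Fn[d /eqP]] := eqVneq F`_n 0; first by rewrite lead_coef0 horner0 !mul0r.
rewrite sk eqr_nat => /eqP-> [c Fc]; rewrite addnK {1}Fc !hornerE.
rewrite Fc lead_coefZ (monicP _) ?mulr1 // monic_exp //.
by rewrite -[b]opprK polyCN monicXsubC.
Qed.

End Evaluation.

(** * Intertwiners between density modules *)

Section Intertwiners.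
Context {K : numFieldType}.
Implicit Types (F G : {poly {poly K}}) (x u alpha beta : K).

Lemma ev_coef_alpha alpha beta i m x u :
  ev (coef_alpha alpha beta i m) x u = x + alpha * u + beta.
Proof. by rewrite !evE. Qed.

Lemma coef_alpha0 alpha beta i m : (coef_alpha alpha beta i m)`_0 = 'X + beta%:P.
Proof.
by rewrite /coef_alpha /pd /plam /pcst !coefD coefCM !coefC coefX mulr0 addr0.
Qed.

Lemma coef_alpha1 alpha beta i m : (coef_alpha alpha beta i m)`_1 = alpha%:P.
Proof.
by rewrite /coef_alpha /pd /plam /pcst !coefD coefCM !coefC coefX mulr1 addr0 add0r.
Qed.

(** At lambda = 0 the equation reads
    [F(x, u) (G'_0(x) - G_0(x + u) + u) = 0] for the constant terms in lambda;
    cancelling [F] leaves [G_0(x + u) = G'_0(x) + u]. *)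
Lemma intertwines_degree0 F G G' : F != 0 -> intertwines G G' F ->
  exists b, G`_0 = 'X + b%:P /\ G'`_0 = 'X + b%:P.
Proof.
move=> F_neq0 E.
have : F * ((G'`_0)%:P - (map_poly polyC G`_0 \Po (pd K + plam K)) + 'X) = 0.
  apply: ev_eq0 => x u; have := E x 0 u.
  rewrite !addr0 !sub0r !add0r => {}E.
  rewrite evM !(evD, evN) !evC ev_plam ev_subst evD ev_pd ev_plam.
  by rewrite !ev_at0 in E; apply: (lin_comb (k := 1) E); ring.
move/eqP; rewrite mulf_eq0 (negbTE F_neq0) /= => /eqP E0.
have {}E0 x u : (G`_0).[x + u] = (G'`_0).[x] + u.
  have /= := congr1 (fun H => ev H x u) E0.
  rewrite ev0 !(evD, evN) !evC ev_plam ev_subst evD ev_pd ev_plam.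
  by move=> E1; apply: (lin_comb (k := -1) E1); ring.
have GX : G`_0 = 'X + ((G'`_0).[0])%:P.
  apply: poly_fun_inj => x.
  by have := E0 0 x; rewrite add0r => {}E0; rewrite !hornerE E0; ring.
exists (G'`_0).[0]; split=> //.
apply: poly_fun_inj => x.
by have := E0 x 0; rewrite addr0 GX !hornerE => ->; ring.
Qed.

(** Let psi be the coefficient of lambda in [F].  The Euler equation reads
    [(psi(del + lambda) - psi(del)) F = (del + beta) F_del + lambda F_lambda - F].
    The right side has at most the degree of [F] in lambda, so psi is a constant,
    and then [F] is homogeneous of degree 1. *)
Lemma weight_density F beta : F`_0 = 'X + beta%:P -> intertwines F F F ->
  exists alpha, F = coef_alpha alpha beta 0 0.
Proof.
move=> F0 E; have E1 := intertwines_euler E.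
pose psi := F`_1.
have F_neq0 : F != 0.
  apply: contra_eq_neq F0 => ->; rewrite coef0 eq_sym.
  by rewrite -size_poly_eq0 size_XaddC.
pose H := map_poly polyC psi \Po (pd K + plam K) - psi%:P.
have evH x u : ev H x u = psi.[x + u] - psi.[x].
  by rewrite evD evN evC ev_subst !evE.
have HF : H * F = ('X + beta%:P)%:P * dpartial F + 'X * F^`() - F.
  apply: ev_inj => x u; rewrite evM evH !(evD, evN) !evM evC hornerD hornerX hornerC.
  rewrite -/(plam K) ev_plam; move: (E1 x u); rewrite F0 !hornerE -/psi => E2.
  by apply: (lin_comb (k := -1) E2); ring.
have size_H : (size H <= 1)%N.
  have [->|H_neq0] := eqVneq H 0; first by rewrite size_poly0.
  have le_size : (size (H * F)%R <= size F)%N.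
    rewrite HF (leq_trans (size_polyD _ _)) // geq_max size_polyN leqnn andbT.
    rewrite (leq_trans (size_polyD _ _)) // geq_max.
    apply/andP; split; apply/leq_sizeP => n le_n.
      by rewrite coefCM coef_dpartial nth_default // deriv0 mulr0.
    rewrite coefXM; case: n le_n => //= n le_n.
    by rewrite coef_deriv nth_default ?mul0rn.
  rewrite -(leq_add2r (size F)); move: le_size.
  rewrite size_mul // add1n; case: (size H + size F)%N => // k.
have psi_const u : psi.[u] = psi.[0].
  have H_const x : ev H x u = ev H x 0.
    by rewrite /ev (size1_polyC size_H) !hornerC.
  by have := H_const 0; rewrite !evH !addr0 add0r subrr => /eqP; rewrite subr_eq0 => /eqP.
have [//|k k1 [c Fc]] := @euler_homogeneous _ F 1 beta F_neq0.
  move=> x u; have := E1 x u; rewrite F0 !hornerE -/psi !psi_const => E2.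
  by apply: (lin_comb (k := 1) E2); ring.
have {}k1 : k = 1%N by apply/eqP; rewrite -(eqr_nat K) -k1.
have {}Fc x u : ev F x u = c 0 * (x + beta) + c 1 * u.
  by rewrite Fc k1 !big_ord_recr big_ord0 /= !expr1 !expr0; ring.
have c0 : c 0 = 1.
  have := ev_at0 F (1 - beta); rewrite Fc F0 !hornerE => E2.
  by apply: (lin_comb (k := 1) E2); ring.
exists (c 1); apply: ev_inj => x u.
by rewrite Fc ev_coef_alpha c0; ring.
Qed.

Lemma density_intertwiners F alpha alpha' beta i m j n : F != 0 ->
  intertwines (coef_alpha alpha beta i m) (coef_alpha alpha' beta j n) F ->
  exists2 k : nat, 1 + alpha - alpha' = k%:R & exists c : nat -> K, forall x u,
    ev F x u = \sum_(n < k.+1) c n * (x + beta) ^+ (k - n) * u ^+ n.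
Proof.
move=> F_neq0 /intertwines_euler E; apply: euler_homogeneous => // x u.
have := E x u; rewrite coef_alpha0 !coef_alpha1 !hornerE => E1.
by apply: (lin_comb (k := 1) E1); ring.
Qed.

(** In each degree only a few values of the equation, at points with
    del + beta = y in {0, 1}, are needed to fix the coefficients. *)
Lemma intertwiner_le2 F alpha alpha' beta i m j n : F != 0 ->
  intertwines (coef_alpha alpha beta i m) (coef_alpha alpha' beta j n) F ->
  forall k, (k <= 2)%N -> 1 + alpha - alpha' = k%:R ->
  exists2 c, c != 0 &
  [\/ [/\ k = 0%N, alpha' = alpha + 1 & F = pcst c],
      [/\ k = 1%N, alpha' = alpha & F = pcst c * coef_alpha alpha beta i m]
    | [/\ k = 2%N, alpha = 1, alpha' = 0 &
       F = pcst c * ((pd K + pcst beta) * (pd K + pcst beta + plam K))]].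
Proof.
move=> F_neq0 E k le_k2 Ek.
have [k' Ek' [c Fc]] := density_intertwiners F_neq0 E.
have {Ek'} kk' : k' = k by apply/eqP; rewrite -(eqr_nat K) -Ek -Ek'.
subst k'.
(* From here on, y stands for the value of del + beta. *)
have {}E y l u : ev F (y - beta + l) u * (y + alpha' * l)
    - (y + u + alpha * l) * ev F (y - beta) u = (l - u) * ev F (y - beta) (l + u).
  by rewrite -E !ev_coef_alpha; ring.
have ne0 (c0 : K) (G : {poly {poly K}}) : F = pcst c0 * G -> c0 != 0.
  by move=> FE; apply: contra_neq F_neq0 => c00; rewrite FE c00 /pcst !polyC0 mul0r.
have {le_k2} : [\/ k = 0%N, k = 1%N | k = 2%N].
  by case: k le_k2 {Ek Fc} => [|[|[|]]] //; constructor.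
case=> k_eq; subst k.
- have {}Fc : F = pcst (c 0).
    by apply: ev_inj => x u; rewrite Fc big_ord1 ev_pcst !mulr1.
  exists (c 0); first by apply: (ne0 _ 1); rewrite mulr1.
  constructor 1; split=> //.
  by apply: (lin_comb (k := -1) Ek); ring.
- have {}Fc x u : ev F x u = c 0 * (x + beta) + c 1 * u.
    by rewrite Fc !big_ord_recr big_ord0 /= !expr1 !expr0; ring.
  have E2 : alpha' = alpha by apply: (lin_comb (k := -1) Ek); ring.
  have c1 : c 1 = c 0 * alpha.
    by have := E 0 1 0; rewrite !Fc E2 => E3; apply: (lin_comb (k := -1) E3); ring.
  have {}Fc : F = pcst (c 0) * coef_alpha alpha beta i m.
    by apply: ev_inj => x u; rewrite Fc evM ev_pcst ev_coef_alpha c1; ring.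
  exists (c 0); first exact: ne0 Fc.
  by constructor 2; split.
have {}Fc x u : ev F x u = c 0 * (x + beta) ^+ 2 + c 1 * (x + beta) * u + c 2 * u ^+ 2.
  by rewrite Fc !big_ord_recr big_ord0 /= !expr1 !expr0; ring.
have E2 : alpha = alpha' + 1 by apply: (lin_comb (k := 1) Ek); ring.
have c2 : c 2 = c 0 * alpha'.
  by have := E 0 1 0; rewrite !Fc E2 => E3; apply: (lin_comb (k := -1) E3); ring.
have c1 : c 1 = c 0 * (1 + 2 * alpha').
  by have := E 1 1 0; rewrite !Fc E2 c2 => E3; apply: (lin_comb (k := -1) E3); ring.
have c0_neq0 : c 0 != 0.
  apply: contra_neq F_neq0 => c00; apply: ev_eq0 => x u.
  by rewrite Fc c2 c1 c00; ring.
have alpha'0 : alpha' = 0.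
  have : 2 * c 0 * alpha' ^+ 2 = 0.
    by have := E 0 1 1; rewrite !Fc E2 c2 c1 => E3; apply: (lin_comb (k := 1) E3); ring.
  by move/eqP; rewrite !mulf_eq0 pnatr_eq0 (negbTE c0_neq0) orbb /= => /eqP.
exists (c 0) => //; constructor 3; split=> //; first by rewrite E2 alpha'0 add0r.
by apply: ev_inj => x u; rewrite Fc !evE c2 c1 alpha'0; ring.
Qed.
End Intertwiners.

(** * The action of the L_i *)

(** The module axiom for basis elements [g], [h] acting on the generator in
    degree [m], with lambda = [l], mu = [u] and del = [x].  In the right side del
    has become - lambda - mu in the bracket, by sesquilinearity. *)
Definition structure_law (K : numFieldType) (a b : K)
    (F : chv_index -> int -> {poly {poly K}}) :=
  forall (g h : chv_index) (m : int) (x l u : K),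
    ev (F h m) (x + l) u * ev (F g (series_target h m)) x l
    - ev (F g m) (x + u) l * ev (F h (series_target g m)) x u
    = ev (chv_coef a b g h) (- (l + u)) l * ev (F (chv_target g h) m) x (l + u).

Definition virasoro_law (K : numFieldType) (f : int -> int -> {poly {poly K}}) :=
  forall (i j m : int) (x l u : K),
    ev (f j m) (x + l) u * ev (f i (j + m)) x l
    - ev (f i m) (x + u) l * ev (f j (i + m)) x u
    = (l - u) * ev (f (i + j) m) x (l + u).

Section Virasoro.
Context {K : numFieldType}.
Implicit Types (x l u alpha beta : K) (i j m : int).

Lemma coef_alpha_law alpha beta : virasoro_law (coef_alpha alpha beta).
Proof. by move=> i j m x l u; rewrite !ev_coef_alpha; ring. Qed.

Lemma coef_A_law (A : int -> bool) beta : virasoro_law (coef_A A beta).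
Proof.
move=> i j m x l u; rewrite /coef_A [j + (i + m)]addrCA -[i + j + m]addrA.
by case: (A m); case: (A (j + m)); case: (A (i + m)); case: (A (i + (j + m)));
  rewrite !evE; ring.
Qed.

(** The normalisation by which the scalars in [scale_cocycle] are read off. *)
Lemma coef_alpha_monic alpha beta i m : ev (coef_alpha alpha beta i m) (1 - beta) 0 = 1.
Proof. by rewrite ev_coef_alpha; ring. Qed.

Lemma coef_A_monic (A : int -> bool) beta i m : ev (coef_A A beta i m) (1 - beta) 0 = 1.
Proof. by rewrite /coef_A; case: (A m); case: (A (i + m)); rewrite !evE; ring. Qed.

Context (f : int -> int -> {poly {poly K}}).
Hypothesis f_law : virasoro_law f.

Lemma virasoro_intertwines j m : intertwines (f 0 m) (f 0 (j + m)) (f j m).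
Proof. by move=> x l u; have := f_law 0 j m x l u; rewrite !add0r. Qed.

Lemma L0_density m beta : (f 0 m)`_0 = 'X + beta%:P ->
  exists alpha, f 0 m = coef_alpha alpha beta 0 0.
Proof.
move=> /weight_density; apply.
by have := virasoro_intertwines 0 m; rewrite add0r.
Qed.

(** If [f i m] vanished, the equation for i and -i would factor
    [(l - u)(x + alpha (l + u) + beta)] into a polynomial in (x + l, u) and one in
    (x, l).  Its zero on l = u is then incompatible with the values at three
    suitable points. *)
Lemma virasoro_neq0 i m beta : (f 0 m)`_0 = 'X + beta%:P -> f i m != 0.
Proof.
move=> /L0_density[alpha f0]; apply/eqP => fi0.
have E x l u : ev (f (- i) m) (x + l) u * ev (f i (- i + m)) x l
    = (l - u) * (x + alpha * (l + u) + beta).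
  have := f_law i (- i) m x l u.
  by rewrite fi0 ev0 mul0r subr0 subrr f0 ev_coef_alpha.
have /eqP := E (- beta - 1) 1 1; rewrite subrr mul0r subrK mulf_eq0.
have -> : ev (f (- i) m) (- beta) 1 == 0 = false.
  apply/eqP => e0; have /eqP := E (- beta + 1) (- 1) 1; rewrite addrK e0 mul0r.
  by rewrite eq_sym (_ : _ * _ = - 2) ?oppr_eq0 ?pnatr_eq0 //; ring.
move=> /= /eqP e0; have /eqP := E (- beta - 1) 1 (- 1); rewrite e0 mulr0.
by rewrite eq_sym (_ : _ * _ = - 2) ?oppr_eq0 ?pnatr_eq0 //; ring.
Qed.

(** Every component is reached from any other one by some L_i, and all [f i m]
    are nonzero, so one nonzero polynomial determines beta everywhere. *)
Lemma virasoro_uniform : (exists i m, f i m != 0) ->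
  exists beta (alpha : int -> K), forall m,
    f 0 m = coef_alpha (alpha m) beta 0 0 /\ forall i, f i m != 0.
Proof.
case=> i0 [m0 /intertwines_degree0/(_ (virasoro_intertwines i0 m0))].
case=> beta [q0 _]; exists beta.
have q m : (f 0 m)`_0 = 'X + beta%:P.
  have := intertwines_degree0 (virasoro_neq0 (m - m0) q0) (virasoro_intertwines _ _).
  by rewrite subrK q0 => -[b [/addrI->]].
exists (fun m => ((f 0 m)`_1).[0]) => m.
split; last by move=> i; apply: virasoro_neq0 (q m).
by have [alpha ->] := L0_density (q m); rewrite coef_alpha1 hornerC.
Qed.

Context (beta : K) (alpha : int -> K).
Hypothesis f0_density : forall m, f 0 m = coef_alpha (alpha m) beta 0 0.
Hypothesis f_neq0 : forall i m, f i m != 0.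

(** Going from m to i + m and back, the degrees of the two intertwiners add up
    to 2, so each is at most 2. *)
Lemma weight_step i m : exists2 c, c != 0 &
  [\/ alpha (i + m) = alpha m + 1 /\ f i m = pcst c,
      alpha (i + m) = alpha m /\ f i m = pcst c * coef_alpha (alpha m) beta 0 0
    | [/\ alpha m = 1, alpha (i + m) = 0 &
       f i m = pcst c * ((pd K + pcst beta) * (pd K + pcst beta + plam K))]].
Proof.
have tw j n : intertwines (coef_alpha (alpha n) beta 0 0)
    (coef_alpha (alpha (j + n)) beta 0 0) (f j n).
  by rewrite -!f0_density; apply: virasoro_intertwines.
have [k Ek _] := density_intertwiners (f_neq0 i m) (tw i m).
have [k' Ek' _] := density_intertwiners (f_neq0 (- i) (i + m)) (tw _ _).
rewrite addKr in Ek'.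
have kk' : (k + k' = 2)%N.
  by apply/eqP; rewrite -(eqr_nat K) natrD -Ek -Ek'; apply/eqP; ring.
have le_k2 : (k <= 2)%N by rewrite -kk' leq_addr.
have [c c_neq0 H] := intertwiner_le2 (f_neq0 i m) (tw i m) le_k2 Ek.
exists c => //; case: H => [[_ ? ?]|[_ ? ?]|[_ ? ? ?]]; first by constructor 1.
  by constructor 2.
by constructor 3.
Qed.

(** Two distinct weights differ by 1, and the step down has degree 2, which
    forces them to be 1 and 0.  Any further weight differs from one of these two
    and therefore also belongs to {0, 1}. *)
Lemma weight_dichotomy : (forall m, alpha m = alpha 0)
  \/ (exists m n, alpha m = 1 /\ alpha n = 0)
     /\ (forall m, alpha m = 0 \/ alpha m = 1).
Proof.
have step m n : alpha m <> alpha n ->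
    (alpha m = 0 /\ alpha n = 1) \/ (alpha m = 1 /\ alpha n = 0).
  move=> ne; have [c _] := weight_step (n - m) m; rewrite subrK.
  case=> [[En _]|[En _]|[Em En _]]; [|by case: ne|by right].
  have [c' _] := weight_step (m - n) n; rewrite subrK.
  case=> [[Em _]|[Em _]|[En' Em _]]; [|by case: ne|by left].
  have /eqP : alpha m - alpha m = 2 by rewrite {1}Em En; ring.
  by rewrite subrr eq_sym pnatr_eq0.
have [|/boolp.existsNP[n ne]] := boolp.EM (forall m, alpha m = alpha 0); first by left.
right; have : exists p q, alpha p = 1 /\ alpha q = 0.
  by case: (step _ _ ne) => -[e1 e2]; [exists 0, n|exists n, 0].
move=> [p [q [ep eq]]]; split; first by exists p, q.
move=> m; have [->|/eqP/step[[? _]|[? _]]] := eqVneq (alpha m) (alpha p); auto.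
Qed.

Section Rescaling.
Context (FL : int -> int -> {poly {poly K}}) (c : int -> int -> K).
Hypothesis FL_law : virasoro_law FL.
Hypothesis FL_monic : forall i m, ev (FL i m) (1 - beta) 0 = 1.
Hypothesis f_FL : forall i m, f i m = pcst (c i m) * FL i m.

(** Comparing the equations of [f] and [FL]: the point l = u = 0 gives
    [c j m * c i (j + m) = c i m * c j (i + m)], and then l = 1, u = -1
    identifies this product with [c (i + j) m].  At del + beta = 1 and
    lambda = 0 the normalisation makes all values of [FL] equal to 1. *)
Lemma scale_cocycle i j m : c j m * c i (j + m) = c (i + j) m.
Proof.
have E x l u : c j m * c i (j + m) * (ev (FL j m) (x + l) u * ev (FL i (j + m)) x l)
    - c i m * c j (i + m) * (ev (FL i m) (x + u) l * ev (FL j (i + m)) x u)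
    = c (i + j) m * ((l - u) * ev (FL (i + j) m) x (l + u)).
  have := f_law i j m x l u; rewrite !f_FL !evM !ev_pcst => E1.
  by apply: (lin_comb (k := 1) E1); ring.
have E0 : c j m * c i (j + m) = c i m * c j (i + m).
  have := E (1 - beta) 0 0; rewrite !addr0 !FL_monic => E1.
  by apply: (lin_comb (k := 1) E1); ring.
have := E (1 - beta) 1 (- 1); rewrite -E0 -mulrBr FL_law subrr !FL_monic mulr1.
by move/mulIf; apply; rewrite opprK -[1 + 1]/(2%:R) pnatr_eq0.
Qed.
End Rescaling.
End Virasoro.

(** * The action of the M_i *)

Section Annihilators.
Context {K : numFieldType}.

Lemma mul_lambda_sub_eq0 (G : {poly {poly K}}) c : (forall x u, (c - u) * ev G x u = 0) -> G = 0.
Proof.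
move=> E; have : (pcst c - plam K) * G = 0.
  by apply: ev_eq0 => x u; rewrite !evE E.
move/eqP; rewrite mulf_eq0 subr_eq0 => /orP[/eqP e|/eqP//].
have := congr1 (fun H => ev H 0 (c + 1)) e; rewrite /= ev_pcst ev_plam.
by move/eqP; rewrite -subr_eq0 opprD addrA subrr sub0r oppr_eq0 oner_eq0.
Qed.

(** Fix del and mu and compare degrees in lambda.  Where the leading coefficient
    of [G] does not vanish, [ev G x l] has the full lambda-degree of [G], which
    the right side cannot exceed; so [ev G (x + l) u] is constant in l. *)
Lemma del_free_of_MM (G : {poly {poly K}}) :
  (forall x l u, ev G (x + l) u * ev G x l = ev G (x + u) l * ev G x u) ->
  forall x u, ev G x u = ev G 0 u.
Proof.
move=> E x u; have [->|G_neq0] := eqVneq G 0; first by rewrite !ev0.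
have [y Gy] : exists y, (lead_coef G).[y] != 0.
  apply/boolp.not_existsP => G0; move/eqP: G_neq0; apply.
  apply/eqP; rewrite -lead_coef_eq0; apply/eqP/poly_fun_eq0 => y.
  by apply/eqP/negPn/negP/G0.
have E1 : (G.[u%:P] \Po ('X + y%:P)) * at_del y G = (ev G y u)%:P * at_del (y + u) G.
  apply: poly_fun_inj => l.
  rewrite !(hornerE, horner_comp) !horner_at_del -/(ev G (l + y) u).
  by rewrite [l + y]addrC E mulrC.
have le_size1 : (size (G.[u%:P])%R <= 1)%N.
  have [->|Gu_neq0] := eqVneq G.[u%:P] 0; first by rewrite size_poly0.
  have size_y : size (at_del y G) = size G by rewrite size_map_poly_id0.
  have : (size ((G.[u%:P] \Po ('X + y%:P)) * at_del y G)%R <= size G)%N.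
    rewrite E1 mul_polyC (leq_trans (size_scale_leq _ _)) //.
    exact: size_poly.
  rewrite size_mul; last 2 first.
  - by rewrite comp_poly2_eq0 // size_XaddC.
  - by rewrite -size_poly_eq0 size_y size_poly_eq0.
  rewrite size_y size_comp_poly2 ?size_XaddC // => le_G.
  rewrite -(leq_add2r (size G)); move: le_G.
  by rewrite add1n; case: (size _ + size G)%N.
by rewrite /ev (size1_polyC le_size1) !hornerC.
Qed.
End Annihilators.

Section CHVStructure.
Context {K : numFieldType} (a b : K) (F : chv_index -> int -> {poly {poly K}}).
Hypothesis F_law : structure_law a b F.
Local Notation f i m := (F (inl i) m).
Local Notation g i m := (F (inr i) m).

Lemma LL_law : virasoro_law (fun i m => f i m).
Proof.
move=> i j m x l u; have /= -> := F_law (inl i) (inl j) m x l u.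
by rewrite !evE; ring.
Qed.

Lemma LM_law i j m x l u :
  ev (g j m) (x + l) u * ev (f i (j + m)) x l
  - ev (f i m) (x + u) l * ev (g j (i + m)) x u
  = ((a - 1) * l - u + b) * ev (g (i + j) m) x (l + u).
Proof.
have /= -> := F_law (inl i) (inr j) m x l u.
by rewrite !evE; ring.
Qed.

Lemma MM_law i j m x l u :
  ev (g j m) (x + l) u * ev (g i (j + m)) x l
  = ev (g i m) (x + u) l * ev (g j (i + m)) x u.
Proof.
have /= := F_law (inr i) (inr j) m x l u.
by rewrite ev0 mul0r => /eqP; rewrite subr_eq0 => /eqP.
Qed.

(** If all L_i act by zero, the bracket of L_0 and M_i kills [g i m]. *)
Lemma L_neq0 : (exists h m, F h m != 0) -> exists i m, f i m != 0.
Proof.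
case=> -[i|i] [m Fhm]; first by exists i, m.
apply: boolp.contrapT => f0; move/eqP: Fhm; apply.
apply: (@mul_lambda_sub_eq0 _ _ b) => x u.
have f_eq0 j n : f j n = 0.
  by have [//|fjn] := eqVneq (f j n) 0; case: f0; exists j, n.
have := LM_law 0 i m x 0 u; rewrite !f_eq0 !ev0 mulr0 mul0r !add0r => E.
by apply: (lin_comb (k := -1) E); ring.
Qed.

Context (beta : K) (alpha : int -> K).
Hypothesis f0_density : forall m, f 0 m = coef_alpha (alpha m) beta 0 0.
Hypothesis f_neq0 : forall i m, f i m != 0.

Lemma M_eq0_of_b_neq0 i m : b <> 0 -> g i m = 0.
Proof.
move=> /eqP b0; apply: ev_eq0 => x u.
have := LM_law 0 i m x 0 u; rewrite !f0_density !ev_coef_alpha !add0r !addr0 => E.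
have /eqP : b * ev (g i m) x u = 0 by apply: (lin_comb (k := -1) E); ring.
by rewrite mulf_eq0 (negbTE b0) => /eqP.
Qed.

Lemma M_eq0_of_M0 : b = 0 -> (forall m, g 0 m = 0) -> forall i m, g i m = 0.
Proof.
move=> b0 g0 i m; apply: (@mul_lambda_sub_eq0 _ _ 0) => x u.
have := LM_law i 0 m x 0 u; rewrite !g0 !ev0 b0 !(mulr0, mul0r, addr0, add0r) => E.
by apply: (lin_comb (k := -1) E); ring.
Qed.

(** Being free of del, the polynomial gamma(lambda) of M_0 satisfies
    [- u gamma(u) = ((a - 1) l - u) gamma(l + u)]: u = 0 gives gamma = 0 unless
    a = 1, and for a = 1 gamma is constant. *)
Lemma M0_const : b = 0 -> exists e : int -> K,
  (forall m, g 0 m = pcst (e m)) /\ (a <> 1 -> forall m, e m = 0).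
Proof.
move=> b0; pose e m := ev (g 0 m) 0 1; exists e.
have free m x u : ev (g 0 m) x u = ev (g 0 m) 0 u.
  by apply: del_free_of_MM => {}x l {}u; have := MM_law 0 0 m x l u; rewrite add0r.
have E m l u : - (u * ev (g 0 m) 0 u) = ((a - 1) * l - u) * ev (g 0 m) 0 (l + u).
  have := LM_law 0 0 m 0 l u; rewrite b0 !f0_density !ev_coef_alpha !add0r !free => E1.
  by apply: (lin_comb (k := 1) E1); ring.
have Ea l m : (a - 1) * l * ev (g 0 m) 0 l = 0.
  by have := E m l 0; rewrite addr0 mul0r subr0 oppr0 => <-.
have a1E : a <> 1 -> forall m, g 0 m = 0.
  move=> /eqP a1 m; apply: (@mul_lambda_sub_eq0 _ _ 0) => x u; rewrite free.
  have /eqP := Ea u m; rewrite -mulrA mulf_eq0 subr_eq0 (negbTE a1) /= => /eqP uE.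
  by rewrite sub0r mulNr uE oppr0.
split=> [m|a1 m]; last by rewrite /e a1E ?ev0.
have [a1|/eqP a1] := eqVneq a 1; last by rewrite /e a1E ?ev0 // /pcst !polyC0.
apply: ev_inj => x u; rewrite free ev_pcst /e.
have := E m (u - 1) 1; rewrite subrK a1 subrr mul0r mul1r sub0r mulN1r.
by move/oppr_inj.
Qed.

(** The bracket of L_i and M_0 expresses [g i m] through [f i m] and the
    constant of M_0. *)
Lemma M_classified : exists d,
  [/\ (a <> 1 \/ b <> 0 -> d = 0), (d = 0 -> forall i m, g i m = 0)
    & d <> 0 -> forall i m, (forall x u, ev (g i m) x u = ev (g i m) 0 u)
      /\ forall x l u, d * (ev (f i m) (x + u) l - ev (f i m) x l)
                       = u * ev (g i m) x (l + u)].
Proof.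
have [b0|/eqP b0] := eqVneq b 0; last first.
  by exists 0; split=> // _ i m; apply: M_eq0_of_b_neq0.
have [e [g0 e0]] := M0_const b0.
have [a1|/eqP a1] := eqVneq a 1; last first.
  exists 0; split=> // _; apply: M_eq0_of_M0 => // m.
  by rewrite g0 e0 // /pcst !polyC0.
have LM0 i m x l u : e m * ev (f i m) x l - ev (f i m) (x + u) l * e (i + m)
    = - u * ev (g i m) x (l + u).
  have := LM_law i 0 m x l u.
  by rewrite add0r addr0 !g0 !ev_pcst a1 b0 subrr mul0r sub0r addr0.
have e_const m : e m = e 0.
  have : pcst (e 0 - e m) * F (inl m) 0 = 0.
    apply: ev_eq0 => x l; rewrite evM ev_pcst.
    have := LM0 m 0 x l 0; rewrite !addr0 oppr0 mul0r => E.
    by apply: (lin_comb (k := 1) E); ring.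
  move/eqP; rewrite mulf_eq0 (negbTE (f_neq0 _ _)) orbF /pcst !polyC_eq0 subr_eq0.
  by move/eqP.
exists (e 0); split=> [[/(_ a1)|/(_ b0)]//|d0|d_neq0 i m].
  by apply: M_eq0_of_M0 => // m; rewrite g0 e_const d0 /pcst !polyC0.
have {}LM0 x l u : e 0 * (ev (f i m) (x + u) l - ev (f i m) x l)
    = u * ev (g i m) x (l + u).
  have := LM0 i m x l u; rewrite !e_const => E.
  by apply: (lin_comb (k := -1) E); ring.
split=> // x u; have := MM_law i 0 m 0 u x.
rewrite !add0r !g0 !ev_pcst !e_const mulrC => E.
by apply: esym; apply: mulIf E; apply/eqP.
Qed.

(** [s] rescales the generators so that the polynomials become those of a
    model. *)
Theorem chv_structure_of_weights : exists FL d (s : int -> K),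
  [/\ forall m, s m != 0,
      forall h m, pcst (s m) * F h m
        = pcst (s (series_target h m)) * series_coef FL d h m,
      a <> 1 \/ b <> 0 -> d = 0
    & (exists al be, FL = coef_alpha al be) \/ (exists A be, FL = coef_A A be)].
Proof.
have [d [ab d0 dn]] := M_classified.
(* At this point every model polynomial takes the value 1. *)
pose c i m := ev (f i m) (1 - beta) 0.
have reduce FL d' : virasoro_law FL -> (forall i m, ev (FL i m) (1 - beta) 0 = 1) ->
    (forall i m, exists c, c != 0 /\ f i m = pcst c * FL i m) ->
    (forall i m, g i m = pcst (d' * c i m)) ->
    exists s : int -> K, (forall m, s m != 0) /\ forall h m, pcst (s m) * F h m
        = pcst (s (series_target h m)) * series_coef FL d' h m.
  move=> FL_law FL_monic fFL gE.
  have cE i m : c i m != 0 /\ f i m = pcst (c i m) * FL i m.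
    have [c0 [c0_neq0 fE]] := fFL i m.
    suff -> : c i m = c0 by [].
    by rewrite /c fE evM ev_pcst FL_monic mulr1.
  have coc := scale_cocycle LL_law FL_law FL_monic (fun i m => (cE i m).2).
  have pcstM (p q : K) : pcst (p * q) = pcst p * pcst q by rewrite /pcst !polyCM.
  have step i m : c (i + m) 0 = c m 0 * c i m by rewrite -coc addr0.
  exists (c ^~ 0); split=> [m|[i|i] m] /=; first by have [] := cE m 0.
    by rewrite (cE i m).2 step pcstM mulrA.
  by rewrite gE step !pcstM; ring.
have [al_const|[[m [n [am an]]] al01]] := weight_dichotomy LL_law f0_density f_neq0.
  pose FL := coef_alpha (alpha 0) beta; exists FL, d.
  have fE i m : exists c, c != 0 /\ f i m = pcst c * FL i m.
    have [c0 c0_neq0] := weight_step LL_law f0_density f_neq0 i m.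
    rewrite !al_const => -[[E _]|[_ fE]|[E1 E2 _]]; last 1 first.
    - by move: E1; rewrite E2 => /esym/eqP; rewrite oner_eq0.
    - have /eqP := E; rewrite -subr_eq0 opprD addrA subrr sub0r oppr_eq0.
      by rewrite oner_eq0.
    by exists c0.
  have [] // := reduce FL d (coef_alpha_law _ _) (coef_alpha_monic _ _) fE; last first.
    by move=> s [s0 sE]; exists s; split=> //; left; exists (alpha 0), beta.
  move=> i m; have [d_eq0|/eqP d_neq0] := eqVneq d 0.
    by rewrite d0 // d_eq0 mul0r /pcst !polyC0.
  have [c0 [_ fE0]] := fE i m; have [free LM] := dn d_neq0 i m.
  have -> : c i m = c0.
    by rewrite /c fE0 evM ev_pcst coef_alpha_monic mulr1.
  apply: ev_inj => x u; rewrite free ev_pcst.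
  have := LM 0 (u - 1) 1; rewrite subrK fE0 !evM !ev_coef_alpha !ev_pcst => E.
  by apply: (lin_comb (k := -1) E); ring.
pose FL := coef_A (fun m => alpha m == 1) beta; exists FL, 0.
(* A step of degree 2 makes g_(i,m) a nonzero multiple of
   d (2 (del + beta) + lambda), while it is free of del if d is nonzero. *)
have d_eq0 : d = 0.
  have [//|/eqP d_neq0] := eqVneq d 0.
  have [c0 c0_neq0] := weight_step LL_law f0_density f_neq0 (n - m) m.
  rewrite subrK am an => -[[/eqP]|[/eqP]|[_ _ fE]].
  - by rewrite eq_sym -[1 + 1]/(2%:R) pnatr_eq0.
  - by rewrite eq_sym oner_eq0.
  have [free LM] := dn d_neq0 (n - m) m.
  have E0 := LM (- beta) 0 1; have E1 := LM (1 - beta) 0 1.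
  have : 2 * d * c0 = 0.
    move: E0 E1; rewrite free => {LM} E0; rewrite free -E0 fE !evE => E1.
    by apply: (lin_comb (k := 1) E1); ring.
  by move/eqP; rewrite !mulf_eq0 (negbTE c0_neq0) pnatr_eq0 orbF => /eqP.
have fE i m0 : exists c, c != 0 /\ f i m0 = pcst c * FL i m0.
  have [c0 c0_neq0 H] := weight_step LL_law f0_density f_neq0 i m0.
  exists c0; split=> //; rewrite /FL /coef_A.
  have ne01 : (0 == 1 :> K) = false by rewrite eq_sym oner_eq0.
  case: H => [[E fE]|[E fE]|[E1 E2 fE]]; last first.
  - by rewrite E1 E2 eqxx ne01.
  - rewrite fE E; case: (al01 m0) => ->; rewrite ?eqxx ?ne01; congr (_ * _).
      by rewrite /coef_alpha /pcst; ring.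
    by rewrite /coef_alpha /pcst; ring.
  have am0 : alpha m0 = 0.
    case: (al01 m0) => // am1; case: (al01 (i + m0)); rewrite E am1.
      by move/eqP; rewrite -[1 + 1]/(2%:R) pnatr_eq0.
    by move/eqP; rewrite -subr_eq0 addrK oner_eq0.
  by rewrite E am0 add0r eqxx ne01 fE mulr1.
have [] // := reduce FL 0 (coef_A_law _ _) (coef_A_monic _ _) fE; last first.
  by move=> s [s0 sE]; exists s; split=> //; right; exists (fun m => alpha m == 1), beta.
by move=> i m0; rewrite d0 // mul0r /pcst !polyC0.
Qed.
End CHVStructure.

Theorem chv_structure (K : numFieldType) (a b : K)
    (F : chv_index -> int -> {poly {poly K}}) :
  structure_law a b F -> (exists h m, F h m != 0) -> exists FL d (s : int -> K),
  [/\ forall m, s m != 0,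
      forall h m, pcst (s m) * F h m
        = pcst (s (series_target h m)) * series_coef FL d h m,
      a <> 1 \/ b <> 0 -> d = 0
    & (exists al be, FL = coef_alpha al be) \/ (exists A be, FL = coef_A A be)].
Proof.
move=> F_law /(L_neq0 F_law)/(virasoro_uniform (LL_law F_law)).
case=> beta [alpha H].
exact: (chv_structure_of_weights F_law (fun m => (H m).1) (fun i m => (H m).2 i)).
Qed.

(** * Structure polynomials of a graded module *)

(** [free_coef] computes every sesquilinear map on cyclic submodules. *)
Lemma sesq_free_coef (K : fieldType) (R V : lmodType {poly K})
    (act : R -> V -> lpoly V) x v w (F : {poly {poly K}}) :
  sesquilinear act -> (forall n, (act x v)@_n = F`_n *: w) ->
  forall p q n, (act (p *: x) (q *: v))@_n = (free_coef p q F)`_n *: w.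
Proof.
move=> sq E p q.
have splitX (r : {poly K}) c : r * 'X + c%:P = c%:P * 1 + 'X * r by rewrite mulr1 addrC mulrC.
have mulX (r : lpoly V) (G : {poly {poly K}}) n : (forall k, r@_k = G`_k *: w) ->
    mul_lambda r n = (G * 'X)`_n *: w.
  by move=> rG; rewrite coefMX; case: n => [|n] /=; rewrite ?scale0r.
elim/poly_ind: p => [|p c IHp] n.
  by rewrite scale0r free_coef0l coef0 scale0r sesq0l // mcoeff0.
rewrite splitX free_coefDl free_coefXl scalerDl -!scalerA scale1r.
rewrite (sesq_linearl sq) (sesq_derl sq) (mulX _ (free_coef p q F)) //.
rewrite coefD coefZ coefN scalerDl scaleNr -scalerA; congr (_ *: _ + _).
elim/poly_ind: q n {IHp} => [|q d IHq] n.
  by rewrite scale0r free_coef0r coef0 scale0r sesq0r // mcoeff0.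
rewrite splitX free_coefDr free_coefXr scalerDl -!scalerA scale1r.
rewrite (sesq_linearr sq) (sesq_derr sq) (mulX _ (free_coef 1 q F)) //.
by rewrite !coefD !coefZ free_coef11 E IHq !scalerDl -!scalerA.
Qed.

Section CoefficientLaw.
Context {K : numFieldType}.
Implicit Types (p q : {poly K}) (F : {poly {poly K}}) (x l u : K).

Lemma ev_free_coef p q F x u :
  ev (free_coef p q F) x u = p.[- u] * q.[x + u] * ev F x u.
Proof. by rewrite /free_coef !evM !ev_subst !evE. Qed.

(** Taylor's formula; the binomial coefficients of [bracket_act] are those of
    the Hasse derivatives. *)
Lemma coef_comp_XaddC p u j : (p \Po ('X + u%:P))`_j = p^`N(j).[u].
Proof.
have -> : p \Po ('X + u%:P) = \poly_(i < size p) p^`N(i).[u].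
  apply: poly_fun_inj => l.
  rewrite !(hornerE, horner_comp) horner_poly [l + u]addrC nderiv_taylor //.
  exact: mulrC.
rewrite coef_poly; case: ltnP => // le_j.
by rewrite nderivn_poly0 ?horner0.
Qed.

(** Passes from the module axiom compared at lambda^m mu^n to its value at
    lambda = [l], mu = [u]: mu is summed away first, for each fixed power of
    lambda, and the result is read as the coefficients of an identity between
    polynomials in lambda. *)
Lemma coef_law_ev (A1 A2 B1 B2 C F : {poly {poly K}}) :
  (forall m n : nat,
    (free_coef 1 A1`_n B1)`_m - (free_coef 1 A2`_m B2)`_n
    = \sum_(k < m.+1) (free_coef C`_k 1 F)`_(m - k + n) *+ 'C(m - k + n, n)) ->
  forall x l u, ev A1 (x + l) u * ev B1 x l - ev A2 (x + u) l * ev B2 x u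
    = ev C (- (l + u)) l * ev F x (l + u).
Proof.
move=> E x l u.
pose Q k := at_del x (free_coef C`_k 1 F).
have E1 m : ((A1.[u%:P] \Po ('X + x%:P)) * at_del x B1)`_m
    - (at_del (x + u) A2 * (ev B2 x u)%:P)`_m
    = \sum_(k < m.+1) (Q k \Po ('X + u%:P))`_(m - k).
  have : \poly_(n < size A1) (at_del x (free_coef 1 A1`_n B1))`_m
     - at_del x (free_coef 1 A2`_m B2) = \sum_(k < m.+1) (Q k)^`N(m - k).
    apply/polyP => n; rewrite coefB coef_poly coef_sum.
    transitivity (((free_coef 1 A1`_n B1)`_m - (free_coef 1 A2`_m B2)`_n).[x]).
      rewrite hornerD hornerN !coef_at_del; case: ltnP => // le_n.
      by rewrite (nth_default _ le_n) free_coef0r coef0 horner0.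
    rewrite E horner_sum; apply: eq_bigr => k _.
    rewrite hornerMn coef_nderivn coef_at_del -[in RHS]bin_sub ?leq_addr //.
    by rewrite addKn.
  move/(congr1 (horner^~ u)) => E1.
  under [RHS]eq_bigr do rewrite coef_comp_XaddC.
  rewrite -horner_sum -E1 hornerD hornerN horner_at_del ev_free_coef hornerC mul1r.
  congr (_ - _); last by rewrite coefMC coef_at_del.
  rewrite horner_poly (horner_coef A1) rmorph_sum /=.
  rewrite mulr_suml coef_sum; apply: eq_bigr => n _.
  rewrite -rmorphXn /= [A1`_n * _]mulrC mul_polyC comp_polyZ -scalerAl coefZ mulrC.
  congr ((polyseq _)`_m * _); apply: poly_fun_inj => y.
  rewrite !(hornerE, horner_comp) !horner_at_del ev_free_coef hornerC mul1r.
  by rewrite [y + x]addrC.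
have {}E1 : (A1.[u%:P] \Po ('X + x%:P)) * at_del x B1
    - at_del (x + u) A2 * (ev B2 x u)%:P
    = \sum_(k < size C) 'X^k * (Q k \Po ('X + u%:P)).
  apply/polyP => m; rewrite coefB E1 coef_sum.
  have Q0 k : (size C <= k)%N -> Q k = 0.
    by move=> le_k; rewrite /Q nth_default // free_coef0l /at_del rmorph0.
  pose N := maxn m.+1 (size C).
  transitivity (\sum_(k < N | (k < m.+1)%N) (Q k \Po ('X + u%:P))`_(m - k)).
    by rewrite -(big_ord_widen_cond _ xpredT (fun k => (Q k \Po ('X + u%:P))`_(m - k)))
       ?leq_maxl.
  rewrite (big_ord_widen N (fun k => ('X^k * (Q k \Po ('X + u%:P)))`_m)) ?leq_maxr //.
  rewrite big_mkcond [RHS]big_mkcond; apply: eq_bigr => k _ /=.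
  rewrite coefXnM ltnS; case: (leqP k m) => _; last by case: ifP.
  by case: ltnP => // /Q0->; rewrite comp_poly0 coef0.
have := congr1 (horner^~ l) E1; rewrite !(hornerE, horner_comp) !horner_at_del.
rewrite -/(ev A1 (l + x) u) [l + x]addrC => ->.
rewrite horner_sum [ev C _ _]/ev (horner_coef C) horner_sum mulr_suml.
apply: eq_bigr => k _; rewrite -rmorphXn !(hornerE, horner_comp) horner_at_del ev_free_coef hornerC mulr1.
by rewrite mulrA [_ ^+ k * _]mulrC.
Qed.
End CoefficientLaw.

(** * Coordinates and the isomorphism with a model *)

Section GradedBasis.
Context (K : fieldType) (V : lmodType {poly K}) (Vg : int -> V -> Prop).
Context (w : int -> V).
Hypothesis V_grading : is_grading Vg.
Hypothesis w_basis : forall m, freely_generated_by (Vg m) (w m).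

Definition lincomb (s : {malg {poly K}[int]}) : V :=
  \sum_(m <- msupp s) s@_m *: w m.

Lemma lincombE s (A : {fset int}) : (msupp s `<=` A)%fset ->
  lincomb s = \sum_(m <- A) s@_m *: w m.
Proof.
move=> sA; rewrite /lincomb (big_fset_incl _ sA) // => m _ /mcoeff_outdom->.
by rewrite scale0r.
Qed.

Lemma lincombU m : lincomb << 1 *g m >> = w m.
Proof.
rewrite (@lincombE _ [fset m]%fset) ?msuppU_le //.
by rewrite big_seq_fset1 mcoeffUU scale1r.
Qed.

Lemma lincomb_linear (p : {poly K}) s t :
  lincomb (p *: s + t) = p *: lincomb s + lincomb t.
Proof.
pose A := (msupp s `|` msupp t `|` msupp (p *: s + t))%fset.
have sA : (msupp s `<=` A)%fset by rewrite /A -fsetUA fsubsetUl.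
have tA : (msupp t `<=` A)%fset by rewrite /A fsetUAC fsubsetUr.
have stA : (msupp (p *: s + t)%R `<=` A)%fset by rewrite /A fsubsetUr.
rewrite (lincombE sA) (lincombE tA) (lincombE stA) scaler_sumr -big_split.
by apply: eq_bigr => m _; rewrite /= mcoeffD mcoeffZ scalerDl scalerA.
Qed.

Lemma lincomb_eq0 s : lincomb s = 0 -> s = 0.
Proof.
move=> s0; pose c : {malg V[int]} := [malg m in msupp s => s@_m *: w m].
have cE m : c@_m = s@_m *: w m.
  by rewrite mcoeffE; case: msuppP; rewrite ?scale0r.
have c0 : c = 0.
  apply: (grading_direct V_grading) => [m|].
    have [Vw _ _] := w_basis m; rewrite cE -[X in Vg m X]addr0.
    exact: (grading_linear V_grading) Vw (grading_zero V_grading m).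
  rewrite -[RHS]s0 (@big_fset_incl _ _ _ _ (msupp c) (msupp s)).
  - by apply: eq_bigr => m _; rewrite cE.
  - apply/fsubsetP => m; apply: contraLR => m_out.
    by rewrite -mcoeff_eq0 cE (mcoeff_outdom m_out) scale0r.
  - by move=> m _ /mcoeff_outdom.
apply/malgP => m; rewrite mcoeff0.
have [_ _] := w_basis m; apply; rewrite -cE c0; exact: mcoeff0.
Qed.

Lemma lincomb_surj v : exists s, lincomb s = v.
Proof.
have [c [cV ->]] := grading_span V_grading v.
have [p cp] : {p : int -> {poly K} & forall m, c@_m = p m *: w m}.
  apply: (@boolp.choice _ _ (fun m q => c@_m = q *: w m)) => m.
  by have [_ gen _] := w_basis m; apply: gen.
exists [malg m in msupp c => p m].
rewrite (@lincombE _ (msupp c)).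
  rewrite big_seq [RHS]big_seq; apply: eq_bigr => m m_in.
  by rewrite mcoeffE m_in cp.
apply/fsubsetP => m; apply: contraLR => m_out.
by rewrite -mcoeff_eq0 mcoeffE (negbTE m_out).
Qed.

Lemma lincomb_inj : injective lincomb.
Proof.
move=> s t E; apply/eqP; rewrite -subr_eq0; apply/eqP/lincomb_eq0.
by rewrite -scaleN1r addrC lincomb_linear E scaleN1r addNr.
Qed.

Lemma coordinates :
  {f : {linear V -> {malg {poly K}[int]}} |
     cancel f lincomb /\ cancel lincomb f}.
Proof.
have [f fK] := boolp.choice lincomb_surj.
have f_lin : linear f.
  by move=> p u v; apply: lincomb_inj; rewrite lincomb_linear !fK.
pose fL : {linear V -> {malg {poly K}[int]}} :=
  HB.pack f (GRing.isLinear.Build _ _ _ _ f f_lin).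
exists fL; split=> // s; exact/lincomb_inj/fK.
Qed.
End GradedBasis.

(** A sesquilinear map is determined by its values on generators. *)
Lemma action_transport (K : fieldType) (G H : choiceType) (V : lmodType {poly K})
    (act : {malg {poly K}[G]} -> V -> lpoly V)
    (act' : {malg {poly K}[G]} -> {malg {poly K}[H]} -> lpoly {malg {poly K}[H]})
    (phi : {malg {poly K}[H]} -> V) :
  sesquilinear act -> sesquilinear act' ->
  (forall p s t, phi (p *: s + t) = p *: phi s + phi t) ->
  (forall g h n, phi (act' << 1 *g g >> << 1 *g h >>)@_n
                 = (act << 1 *g g >> (phi << 1 *g h >>))@_n) ->
  forall x s n, phi (act' x s)@_n = (act x (phi s))@_n.
Proof.
move=> sq sq' lin gen.
have phi0 : phi 0 = 0.
  by have := lin (-1) 0 0; rewrite scaleN1r addr0 oppr0 scaleN1r addNr.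
have phiD s t : phi (s + t) = phi s + phi t by rewrite -[s]scale1r lin !scale1r.
have phiZ p s : phi (p *: s) = p *: phi s by rewrite -[p *: s]addr0 lin phi0 addr0.
have phiN s : phi (- s) = - phi s by rewrite -[- s]scaleN1r phiZ scaleN1r.
have phi_mul (p : lpoly {malg {poly K}[H]}) (q : lpoly V) n :
    (forall k, phi p@_k = q@_k) -> phi (mul_lambda p n) = mul_lambda q n.
  by move=> E; case: n => [|n] /=.
move=> x; elim/(@free_ind K G): x => [|c x y IHx IHy|x IH|g] s n.
- by rewrite !sesq0l // !mcoeff0.
- by rewrite (sesq_linearl sq) (sesq_linearl sq') lin IHx IHy.
- rewrite (sesq_derl sq) (sesq_derl sq') phiN; congr (- _).
  exact: phi_mul.
elim/(@free_ind K H): s n => [|c s t IHs IHt|s IH|h] n; last exact: gen.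
- by rewrite phi0 !sesq0r // !mcoeff0.
- by rewrite lin (sesq_linearr sq) (sesq_linearr sq') lin IHs IHt.
- rewrite phiZ (sesq_derr sq) (sesq_derr sq') phiD phiZ IH; congr (_ + _).
  exact: phi_mul.
Qed.

Section ModuleStructure.
Context {K : numFieldType} (a b : K) (V : lmodType {poly K}).
Context (act : CHV a b -> V -> lpoly V) (act_module : conformal_module act).
Context (Vg : int -> V -> Prop) (w : int -> V).
Hypothesis V_grading : is_grading Vg.
Hypothesis act_graded : graded_action (@chv_grading K a b) Vg act.
Hypothesis w_basis : forall m, freely_generated_by (Vg m) (w m).

Local Notation e h := (<< 1 *g (h : chv_index) >> : {malg {poly K}[chv_index]}).

Lemma structure_coefs : exists F : chv_index -> int -> {poly {poly K}},
  forall h m n, (act (e h) (w m))@_n = (F h m)`_n *: w (series_target h m).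
Proof.
have e_graded (h : chv_index) m n : Vg (series_target h m) (act (e h) (w m))@_n.
  have [Vw _ _] := w_basis m.
  case: h => i; apply: act_graded => //.
    by exists 1, 0; rewrite scale1r scale0r addr0.
  by exists 0, 1; rewrite scale1r scale0r add0r.
have ex (hm : chv_index * int) : exists F : {poly {poly K}}, forall n,
    (act (e hm.1) (w hm.2))@_n = F`_n *: w (series_target hm.1 hm.2).
  case: hm => h m /=; have [N N0] := lpoly_bound (act (e h) (w m)).
  have [_ gen _] := w_basis (series_target h m).
  have [p pE] := boolp.choice (fun n => gen _ (e_graded h m n)).
  exists (\poly_(n < N) p n) => n; rewrite coef_poly.
  by case: ltnP => [_|/N0->]; rewrite ?scale0r.
have [F FE] := boolp.choice ex.
by exists (fun h m => F (h, m)) => h m n; rewrite -FE.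
Qed.

Lemma module_structure_law (F : chv_index -> int -> {poly {poly K}}) :
  (forall h m n, (act (e h) (w m))@_n = (F h m)`_n *: w (series_target h m)) ->
  structure_law a b F.
Proof.
move=> FE g h m.
have sq := cm_sesquilinear act_module.
have t_comp : series_target g (series_target h m)
    = series_target (chv_target g h) m.
  by case: g h => [i|i] [j|j] /=; rewrite addrA.
have t_comm : series_target h (series_target g m)
    = series_target (chv_target g h) m.
  by rewrite -t_comp; case: g h {t_comp} => [i|i] [j|j] /=; rewrite addrCA.
move=> x l u; apply: coef_law_ev => {x l u} p n.
have [_ _ w_free] := w_basis (series_target (chv_target g h) m).
apply/eqP; rewrite -subr_eq0; apply/eqP/w_free; rewrite scalerBl.
have actZ (k : chv_index) j q r : (act (e k) (q *: w j))@_r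
    = (free_coef 1 q (F k j))`_r *: w (series_target k j).
  by rewrite -[X in act X _]scale1r (sesq_free_coef sq (FE k j)).
have := cm_law act_module (e g) (e h) (w m) p n.
rewrite !FE !actZ t_comp t_comm => E; rewrite scalerBl {}E.
rewrite scaler_suml /bracket_act -sumrB big1 // => k _.
have -> : (lca_bracket (e g : CHV a b) (e h))@_(k : nat)
    = ((chv_coef a b g h)`_k) *: e (chv_target g h) :> CHV a b.
  by rewrite monalgUZ mulr1; apply: free_action_gen.
rewrite -[w m]scale1r (sesq_free_coef sq (FE _ m)).
by rewrite scalerMnl subrr.
Qed.

Lemma coefs_isomorphism (F : chv_index -> int -> {poly {poly K}}) :
  (forall h m n, (act (e h) (w m))@_n = (F h m)`_n *: w (series_target h m)) ->
  isomorphic_actions act (free_action series_target F).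
Proof.
move=> FE; have [f [fK Kf]] := coordinates V_grading w_basis.
exists f; split; first by exists (lincomb w).
move=> x v n.
have gen g h k : lincomb w (free_action series_target F (e g) << 1 *g h >>)@_k
    = (act (e g) (lincomb w << 1 *g h >>))@_k.
  rewrite free_action_gen !lincombU FE.
  by rewrite -[_`_k in LHS]mulr1 -monalgUZ -[_ *: _]addr0 lincomb_linear lincombU
             /lincomb msupp0 big_seq_fset0 addr0.
have tr := action_transport (cm_sesquilinear act_module)
  (free_action_sesquilinear _ _) (lincomb_linear w) gen.
by rewrite -[v in LHS]fK -tr Kf.
Qed.

(** Otherwise [act] would be transported from the zero action. *)
Lemma coefs_neq0 (F : chv_index -> int -> {poly {poly K}}) : nontrivial_action act ->
  (forall h m n, (act (e h) (w m))@_n = (F h m)`_n *: w (series_target h m)) ->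
  exists h m, F h m != 0.
Proof.
move=> [x [v act_neq0]] FE; apply: boolp.contrapT => F0; apply: act_neq0.
have [f [fK Kf]] := coordinates V_grading w_basis.
have mul_lambda0 (W : zmodType) n : mul_lambda (0 : lpoly W) n = 0.
  by case: n => //= n; rewrite mcoeff0.
have sq0 : @sesquilinear K (chv_carrier K) (series_carrier K) (fun _ _ => 0).
  by split=> *; rewrite ?mul_lambda0 ?mcoeff0 ?scaler0 ?oppr0 ?addr0.
have lincomb0 : lincomb w 0 = 0 by rewrite /lincomb msupp0 big_seq_fset0.
have tr := @action_transport _ _ _ _ act (fun _ _ => 0) (lincomb w)
  (cm_sesquilinear act_module) sq0 (lincomb_linear w).
apply/malgP => n; rewrite -[v]fK -tr ?mcoeff0 // => h m k.
rewrite mcoeff0 lincombU FE lincomb0.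
have [->|Fhm] := eqVneq (F h m) 0; first by rewrite coef0 scale0r.
by case: F0; exists h, m.
Qed.
End ModuleStructure.

(** Both cases of the classification at once: the models with d = 0 are those on
    which the M_i act by zero. *)
Theorem graded_intermediate_series (K : numFieldType) (a b : K)
    (V : lmodType {poly K}) (act : CHV a b -> V -> lpoly V) :
  graded_free_intermediate_series (@chv_grading K a b) act ->
  nontrivial_action act ->
  exists d, (a <> 1 \/ b <> 0 -> d = 0) /\
    ((exists alpha beta, isomorphic_actions act (series_Vd alpha beta d))
     \/ (exists A beta, isomorphic_actions act (series_VAd A beta d))).
Proof.
move=> [act_module [Vg [V_grading act_graded Vg_free]]] act_neq0.
have [w w_basis] := boolp.choice Vg_free.
have [F FE] := structure_coefs act_graded w_basis.
have F_law := module_structure_law act_module w_basis FE.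
have F_neq0 := coefs_neq0 act_module V_grading w_basis act_neq0 FE.
have [FL [d [s [s_neq0 sF ab FLE]]]] := chv_structure F_law F_neq0.
exists d; split=> //.
suff iso : isomorphic_actions act (series_action FL d).
  case: FLE => [[alpha [beta FLE]]|[A [beta FLE]]]; [left|right].
    by exists alpha, beta; rewrite /series_Vd -FLE.
  by exists A, beta; rewrite /series_VAd -FLE.
have s_unit m : (s m)^-1%:P * (s m)%:P = 1 :> {poly K} by rewrite -polyCM mulVf.
pose w' m := (s m)%:P *: w m.
have w'_basis m : freely_generated_by (Vg m) (w' m).
  have [Vw gen free] := w_basis m; split.
  - rewrite /w' -[X in Vg m X]addr0.
    exact: (grading_linear V_grading) Vw (grading_zero V_grading m).
  - move=> u /gen[p ->]; exists (p * (s m)^-1%:P).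
    by rewrite scalerA -mulrA s_unit mulr1.
  - move=> p; rewrite scalerA => /free/eqP.
    by rewrite mulf_eq0 polyC_eq0 (negbTE (s_neq0 m)) orbF => /eqP.
apply: (coefs_isomorphism act_module V_grading w'_basis) => h m n.
rewrite (sesqZr _ _ _ _ (cm_sesquilinear act_module)) FE !scalerA mulrC.
have /polyP/(_ n) := sF h m; rewrite /pcst !coefCM => sFn.
by rewrite [_ * (s m)%:P]mulrC sFn mulrC.
Qed.

Theorem theorem6p3 (R : realType) (a b : R[i]) (V : lmodType {poly R[i]})
    (act : CHV a b -> V -> lpoly V)
    (HV : graded_free_intermediate_series (@chv_grading R[i] a b) act)
    (Hnt : nontrivial_action act) :
  ((a <> 1 \/ b <> 0) ->
     (exists alpha beta : R[i],
        isomorphic_actions act (series_V alpha beta))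
     \/ (exists (A : int -> bool) (beta : R[i]),
           isomorphic_actions act (series_VA A beta)))
  /\
  ((a = 1 /\ b = 0) ->
     (exists alpha beta d : R[i],
        isomorphic_actions act (series_Vd alpha beta d))
     \/ (exists (A : int -> bool) (beta d : R[i]),
           isomorphic_actions act (series_VAd A beta d))).
Proof.
have [d [d_eq0 iso]] := graded_intermediate_series HV Hnt; split=> [/d_eq0 d0|_].
  by move: iso; rewrite d0.
case: iso => [[alpha [beta iso]]|[A [beta iso]]]; [left|right].
  by exists alpha, beta, d.
by exists A, beta, d.
Qed.
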